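(* Let $m \in \mathbb{N}_0$, let $N = \dim \Pi_m$, and let $X = \{x_1,\ldots,x_N\} \subset \Omega$ be $\Pi_m$-unisolvent. Suppose that $\lim_{\ell \to \infty} L[\phi_\alpha^\ell] = L[x^\alpha]$ for every $\alpha \in \mathbb{N}_0^d$ with $|\alpha| \leq m$, and that there are constants $\ell_0 > 1$ and $C_L < \infty$ such that $$L\Bigg[\sum_{|\alpha| \geq m+1} \frac{|a_\alpha|}{\ell_0^{|\alpha|-(m+1)} \sqrt{\alpha!}} \, |x^\alpha| \Bigg] \leq C_L$$ for every real sequence $(a_\alpha)_{\alpha \in \mathbb{N}_0^d}$ with $\sum_{\alpha \in \mathbb{N}_0^d} a_\alpha^2 \leq 1$. Then $$\lim_{\ell \to \infty} w_\ell^* = w_{\mathrm{pol}} \quad \text{and} \quad e_\ell\big(Q_X(w_\ell^* )\big) = \mathcal{O}\big(\ell^{-(m+1)}\big) \quad \text{as } \ell \to \infty,$$ where $w_\ell^* \in \mathbb{R}^N$ are the worst-case optimal weights for the Gaussian kernel $K_\ell$ and $w_{\mathrm{pol}} \in \mathbb{R}^N$ are the weights of the unique polynomial cubature rule such that $Q_X(w_{\mathrm{pol}})[p] = L[p]$ for every $p \in \Pi_m$.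
   Context: $\Omega$ is a subset of $\mathbb{R}^d$ with non-empty interior. $L \colon C(\Omega) \to \mathbb{R}$ is a positive linear functional ($L[f] \geq 0$ whenever $f \geq 0$) on the continuous real-valued functions on $\Omega$, satisfying $L[|p|] < \infty$ for every polynomial $p$. For a multi-index $\alpha \in \mathbb{N}_0^d$: $|\alpha| = \alpha_1 + \cdots + \alpha_d$, $\alpha! = \alpha_1! \cdots \alpha_d!$, $x^\alpha = x_1^{\alpha_1}\cdots x_d^{\alpha_d}$. By $L[x^\alpha]$ we mean $L$ applied to the function $x \mapsto x^\alpha$, and similarly for other expressions in $x$. $\Pi_m = \mathrm{span}\{x^\alpha : \alpha \in \mathbb{N}_0^d, |\alpha| \leq m\}$ is the space of $d$-variate polynomials of degree at most $m$. A set $X \subset \Omega$ of distinct points is $\Pi_m$-unisolvent if $\# X = \dim \Pi_m = \binom{m+d}{d}$ and the zero function is the only element of $\Pi_m$ vanishing on $X$. For $\ell > 0$, $\phi_\alpha^\ell(x) = e^{-\|x\|_2^2/(2\ell^2)} x^\alpha$. The Gaussian kernel with length-scale $\ell>0$ is $K_\ell(x,x') = \exp(-\|x-x'\|_2^2/(2\ell^2))$ on $\Omega \times \Omega$, and $\mathcal{H}(K_\ell) \subset C(\Omega)$ is its reproducing kernel Hilbert space. For $w = (w(1),\ldots,w(N)) \in \mathbb{R}^N$, the cubature rule is $Q_X(w)[f] = \sum_{n=1}^N w(n) f(x_n)$. Its worst-case error is $e_\ell(Q_X(w)) = \sup_{\|f\|_{\mathcal{H}(K_\ell)} \leq 1}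 |L[f] - \sum_{n=1}^N w(n) f(x_n)|$. The worst-case optimal weights are $w_\ell^* = \arg\min_{w \in \mathbb{R}^N} e_\ell(Q_X(w))$; they are unique and solve the linear system $\sum_{k=1}^N K_\ell(x_n,x_k) w_\ell^*(k) = L[K_\ell(\cdot,x_n)]$, $n=1,\ldots,N$. *)

(* Defs.v *)
From HB Require Import structures.
From mathcomp Require Import all_boot all_order all_algebra.
From mathcomp Require Import all_classical all_reals all_analysis.
Import Order.TTheory GRing.Theory Num.Theory.
Import numFieldNormedType.Exports.

Set Implicit Arguments.
Unset Strict Implicit.
Unset Printing Implicit Defensive.

Local Open Scope classical_set_scope.
Local Open Scope ring_scope.

(* A subset Om of R^d is used as a type through the coercion set_type, which
   carries the topology induced by R^d; thus f : Om -> R is a function on Om,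
   [continuous f] means f \in C(Om), and [sigL Om p] is the restriction to Om
   of a function p on R^d. *)

Definition multi_index (d : nat) := {ffun 'I_d -> nat}.

Definition mabs (d : nat) (al : multi_index d) : nat := (\sum_i al i)%N.

Definition mfact (d : nat) (al : multi_index d) : nat := (\prod_i (al i)`!)%N.

Definition monom (R : realType) (d : nat) (al : multi_index d)
    (x : 'rV[R]_d) : R :=
  \prod_i x ord0 i ^+ al i.

(* The Euclidean norm squared (the norm of the library on 'rV is the sup norm). *)
Definition sqnorm2 (R : realType) (d : nat) (x : 'rV[R]_d) : R :=
  \sum_i x ord0 i ^+ 2.

Definition poly_space (R : realType) (d m : nat) : set ('rV[R]_d -> R) :=
  [set p | exists (s : seq (multi_index d)) (c : multi_index d -> R),
     (forall al, al \in s -> (mabs al <= m)%N) /\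
     p = fun x => \sum_(al <- s) c al * monom al x].

Definition unisolvent (R : realType) (d m N : nat) (Om : set 'rV[R]_d)
    (x : 'I_N -> Om) : Prop :=
  [/\ injective x,
      N = 'C(m + d, d)
    & forall p : 'rV[R]_d -> R, poly_space m p ->
        (forall n, sigL Om p (x n) = 0) -> p = fun=> 0].

(* A positive linear functional on C(T) is allowed to be infinite on functions
   that are too large, as integration against a Gaussian measure is: it is
   additive on nonnegative functions, with values in [0, +oo], and linear on
   the functions f such that L[|f|] < +oo.  The values of L at discontinuous
   functions are irrelevant.  Functionals with values in R are a special case,
   see [real_positive_functional] below. *)
Record positive_functional (R : realType) (T : topologicalType)
    (L : (T -> R) -> \bar R) : Prop := {
  posf_ge0 : forall f : T -> R, continuous f ->
    (forall x, 0 <= f x) -> (0 <= L f)%E ;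
  posf_add : forall f g : T -> R, continuous f -> continuous g ->
    (forall x, 0 <= f x) -> (forall x, 0 <= g x) ->
    L (fun x => f x + g x) = (L f + L g)%E ;
  posf_linear : forall (a : R) (f g : T -> R), continuous f -> continuous g ->
    (L (fun x => `|f x|)%R < +oo)%E -> (L (fun x => `|g x|)%R < +oo)%E ->
    L (fun x => a * f x + g x) = (a%:E * L f + L g)%E }.

Lemma real_positive_functional (R : realType) (T : topologicalType)
    (L : (T -> R) -> R) :
  (forall f : T -> R, continuous f -> (forall x, 0 <= f x) -> 0 <= L f) ->
  (forall (a : R) (f g : T -> R), continuous f -> continuous g ->
     L (fun x => a * f x + g x) = a * L f + L g) ->
  positive_functional (fun f => (L f)%:E).
Proof.
move=> L_ge0 L_lin; split=> [f cf f_ge0|f g cf cg _ _|a f g cf cg _ _].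
- by rewrite lee_fin L_ge0.
- rewrite -EFinD -[L f]mul1r -L_lin//.
  by congr (L _)%:E; apply/funext => x; rewrite mul1r.
- by rewrite L_lin.
Qed.

Record inner_function_space (R : realType) (T : Type) := InnerFunctionSpace {
  fcarrier :> (T -> R) -> Prop ;
  fdot : (T -> R) -> (T -> R) -> R }.

Definition fnorm (R : realType) (T : Type) (H : inner_function_space R T)
    (f : T -> R) : R :=
  Num.sqrt (fdot H f f).

(* H is a Hilbert space of functions on T in which K reproduces values; by the
   Moore-Aronszajn theorem there is exactly one for each positive semidefinite
   K.  [fdot H] is only meaningful on the carrier of H. *)
Record is_rkhs (R : realType) (T : Type) (K : T -> T -> R)
    (H : inner_function_space R T) : Prop := {
  rkhs_zero : H (fun=> 0) ;
  rkhs_lin : forall (a : R) f g, H f -> H g -> H (fun x => a * f x + g x) ;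
  rkhs_dotC : forall f g, H f -> H g -> fdot H f g = fdot H g f ;
  rkhs_dot_lin : forall (a : R) f g h, H f -> H g -> H h ->
    fdot H (fun x => a * f x + g x) h = a * fdot H f h + fdot H g h ;
  rkhs_dot_ge0 : forall f, H f -> 0 <= fdot H f f ;
  rkhs_dot_eq0 : forall f, H f -> fdot H f f = 0 -> f = fun=> 0 ;
  rkhs_complete : forall u : nat -> T -> R, (forall n, H (u n)) ->
    (forall e : R, 0 < e -> exists n0 : nat, forall p q : nat,
       (n0 <= p)%N -> (n0 <= q)%N ->
       fnorm H (fun x => u p x - u q x) < e) ->
    exists2 f, H f & fnorm H (fun x => u n x - f x) @[n --> \oo] --> (0 : R) ;
  rkhs_kernel : forall y, H (fun x => K x y) ;
  rkhs_repr : forall f y, H f -> f y = fdot H f (fun x => K x y) }.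

Definition gauss_kernel (R : realType) (d : nat) (Om : set 'rV[R]_d) (l : R)
    (x y : Om) : R :=
  expR (- sqnorm2 (\val x - \val y) / (2 * l ^+ 2)).

Definition phi (R : realType) (d : nat) (l : R) (al : multi_index d)
    (x : 'rV[R]_d) : R :=
  expR (- sqnorm2 x / (2 * l ^+ 2)) * monom al x.

(* The sum converges at every x when a is square-summable and 0 < l0, by the
   Cauchy-Schwarz inequality, so that [fine] loses nothing. *)
Definition tail_series (R : realType) (d m : nat) (l0 : R)
    (a : multi_index d -> R) (x : 'rV[R]_d) : R :=
  fine (\esum_(al in [set al : multi_index d | (m.+1 <= mabs al)%N])
    (`|a al| / (l0 ^+ (mabs al - m.+1) * Num.sqrt (mfact al)%:R)
     * `|monom al x|)%:E)%E.

Definition cubature (R : realType) (T : Type) (N : nat) (x : 'I_N -> T)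
    (w : 'rV[R]_N) (f : T -> R) : R :=
  \sum_n w ord0 n * f (x n).

Definition exact_on_poly_space (R : realType) (d m N : nat) (Om : set 'rV[R]_d)
    (L : (Om -> R) -> \bar R) (x : 'I_N -> Om) (w : 'rV[R]_N) : Prop :=
  forall p : 'rV[R]_d -> R, poly_space m p ->
    (cubature x w (sigL Om p))%:E = L (sigL Om p).

Definition worst_case_error (R : realType) (T : Type)
    (H : inner_function_space R T) (L : (T -> R) -> \bar R) (N : nat)
    (x : 'I_N -> T) (w : 'rV[R]_N) : \bar R :=
  ereal_sup [set `|L f - (cubature x w f)%:E|%E
            | f in [set f | H f /\ fnorm H f <= 1]].

Definition worst_case_optimal (R : realType) (T : Type)
    (H : inner_function_space R T) (L : (T -> R) -> \bar R) (N : nat)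
    (x : 'I_N -> T) (w : 'rV[R]_N) : Prop :=
  forall v : 'rV[R]_N,
    (worst_case_error H L x w <= worst_case_error H L x v)%E.

(* Main.v *)
(** The Gaussian kernel is the sum of [psi al x * psi al y] over all multi-indices
    [al], where [psi al] is [phi l al] divided by [l ^+ |al| * sqrt al!].

    By the Riesz theorem each [psi al] has norm at most 1 in the RKHS, and every
    f in the unit ball is a uniform limit of finite sums of [a al * psi al] whose
    coefficients have square sum at most about 1.  If a rule is exact on the [phi l al]
    with [|al| <= m], only the terms with [|al| > m] contribute to its error on such
    a sum, and they are at most [l ^- m.+1] times the tail series, so that the error
    is O(l^-(m+1)), uniformly over weights that stay bounded.  Such weights exist, as
    they solve a Vandermonde system whose right-hand side [L (phi l al)] converges;
    this bounds the error of the optimal weights.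

    Conversely, applying the error bound of the optimal weights to [phi l al], of norm
    O(l^|al|), shows that they integrate [phi l al] up to O(1/l) when [|al| <= m], so
    they solve the same Vandermonde system in the limit. *)
Require Import Defs.
From HB Require Import structures.
From mathcomp Require Import all_boot all_order all_algebra.
From mathcomp Require Import all_classical all_reals all_analysis.
From mathcomp Require Import ring lra.
Import Order.TTheory GRing.Theory Num.Theory.
Import numFieldNormedType.Exports.

Set Implicit Arguments.
Unset Strict Implicit.
Unset Printing Implicit Defensive.

Local Open Scope classical_set_scope.
Local Open Scope ring_scope.

(** * Reproducing kernel Hilbert spaces *)

Section ReproducingKernelHilbertSpace.
Variables (R : realType) (T : Type) (K : T -> T -> R).
Variables (H : inner_function_space R T) (HK : is_rkhs K H).

Lemma rkhsZ (a : R) f : H f -> H (fun x => a * f x).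
Proof.
move=> Hf; have := rkhs_lin HK a Hf (rkhs_zero HK).
by congr (fcarrier H _); apply/funext => x; rewrite addr0.
Qed.

Lemma rkhsB f g : H f -> H g -> H (fun x => f x - g x).
Proof.
move=> Hf Hg; have := rkhs_lin HK (-1) Hg Hf.
by congr (fcarrier H _); apply/funext => x; rewrite mulN1r addrC.
Qed.

Lemma fdotZ (a : R) f g : H f -> H g ->
  fdot H (fun x => a * f x) g = a * fdot H f g.
Proof.
move=> Hf Hg; pose z : T -> R := fun=> 0.
have Hz : H z := rkhs_zero HK.
have z0 : fdot H z g = 0.
  have := rkhs_dot_lin HK 1 Hz Hz Hg; rewrite (_ : (fun x => _) = z); first lra.
  by apply/funext => x; rewrite /z mulr0 addr0.
have := rkhs_dot_lin HK a Hf Hz Hg; rewrite z0 addr0 => <-.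
by congr fdot; apply/funext => x; rewrite addr0.
Qed.

Lemma fdotB f g h : H f -> H g -> H h ->
  fdot H (fun x => f x - g x) h = fdot H f h - fdot H g h.
Proof.
move=> Hf Hg Hh; have := rkhs_dot_lin HK (-1) Hg Hf Hh.
rewrite mulN1r addrC => <-.
by congr fdot; apply/funext => x; rewrite mulN1r addrC.
Qed.

Lemma fdot_sqD (a : R) f g : H f -> H g ->
  fdot H (fun x => a * f x + g x) (fun x => a * f x + g x) =
  a ^+ 2 * fdot H f f + 2 * a * fdot H f g + fdot H g g.
Proof.
move=> Hf Hg; have Hs := rkhs_lin HK a Hf Hg.
rewrite (rkhs_dot_lin HK)// (rkhs_dotC HK Hf Hs) (rkhs_dotC HK Hg Hs).
by rewrite !(rkhs_dot_lin HK)// (rkhs_dotC HK Hg Hf); ring.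
Qed.

Lemma fdot_sqB f g : H f -> H g ->
  fdot H (fun x => f x - g x) (fun x => f x - g x) =
  fdot H f f - 2 * fdot H f g + fdot H g g.
Proof.
move=> Hf Hg; rewrite (_ : (fun x => _) = fun x => -1 * g x + f x).
  by rewrite fdot_sqD// (rkhs_dotC HK Hg Hf); ring.
by apply/funext => x; rewrite mulN1r addrC.
Qed.

Lemma fnorm_ge0 f : 0 <= fnorm H f.
Proof. exact: sqrtr_ge0. Qed.

Lemma sqr_fnorm f : H f -> fnorm H f ^+ 2 = fdot H f f.
Proof. by move=> Hf; rewrite sqr_sqrtr// (rkhs_dot_ge0 HK). Qed.

Lemma fnormZ (a : R) f : H f -> fnorm H (fun x => a * f x) = `|a| * fnorm H f.
Proof.
move=> Hf; rewrite /fnorm fdotZ//; last exact: rkhsZ.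
rewrite (rkhs_dotC HK)//; last exact: rkhsZ.
by rewrite fdotZ// mulrA -expr2 sqrtrM ?sqr_ge0// sqrtr_sqr.
Qed.

(** Cauchy-Schwarz: the square norm of [f] minus its projection on [g] is nonnegative. When
    [fdot H g g = 0] there is no projection to take, but then [g] is the zero function by
    definiteness. *)
Lemma fdot_le f g : H f -> H g -> `|fdot H f g| <= fnorm H f * fnorm H g.
Proof.
move=> Hf Hg; rewrite -ler_sqr ?nnegrE ?mulr_ge0 ?fnorm_ge0//.
rewrite real_normK ?num_real// exprMn !sqr_fnorm//.
have [gg0|gg_neq0] := eqVneq (fdot H g g) 0.
  suff -> : fdot H f g = 0 by rewrite gg0 mulr0 expr0n.
  rewrite (rkhs_dotC HK Hf Hg) (rkhs_dot_eq0 HK Hg gg0).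
  rewrite -[RHS](mul0r (fdot H (fun=> 0) f)) -(fdotZ _ (rkhs_zero HK) Hf).
  by congr fdot; apply/funext => x; rewrite mulr0.
have gg_gt0 : 0 < fdot H g g by rewrite lt_def gg_neq0 (rkhs_dot_ge0 HK).
have := rkhs_dot_ge0 HK (rkhs_lin HK (- fdot H f g / fdot H g g) Hg Hf).
rewrite fdot_sqD// (rkhs_dotC HK Hg Hf) => h.
rewrite -subr_ge0 -(pmulr_lge0 _ gg_gt0).
have -> : (fdot H f f * fdot H g g - fdot H f g ^+ 2) * fdot H g g =
  ((- fdot H f g / fdot H g g) ^+ 2 * fdot H g g +
    2 * (- fdot H f g / fdot H g g) * fdot H f g + fdot H f f) * fdot H g g
  * fdot H g g by field.
by rewrite !mulr_ge0// ltW.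
Qed.

Lemma fnorm_le_add f g : H f -> H g ->
  fnorm H f <= fnorm H (fun x => f x - g x) + fnorm H g.
Proof.
move=> Hf Hg; have Hd := rkhsB Hf Hg.
rewrite -ler_sqr ?nnegrE ?addr_ge0 ?fnorm_ge0// sqrrD !sqr_fnorm//.
rewrite (_ : fdot H f f = 1 ^+ 2 * fdot H (fun x => f x - g x) (fun x => f x - g x) +
  2 * 1 * fdot H (fun x => f x - g x) g + fdot H g g).
  by have := le_trans (ler_norm _) (fdot_le Hd Hg); lra.
rewrite -fdot_sqD//; congr fdot; apply/funext => x; lra.
Qed.

Lemma rkhs_point_le f y : H f -> `|f y| <= fnorm H f * Num.sqrt (K y y).
Proof.
move=> Hf; rewrite {1}(rkhs_repr HK y Hf).
apply: le_trans (fdot_le Hf (rkhs_kernel HK y)) _.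
by rewrite {2}/fnorm -(rkhs_repr HK y (rkhs_kernel HK y)).
Qed.

Lemma kernelC y z : K y z = K z y.
Proof.
have Ky := rkhs_kernel HK y; have Kz := rkhs_kernel HK z.
by rewrite (rkhs_repr HK y Kz) (rkhs_dotC HK)// -(rkhs_repr HK z Ky).
Qed.

(** A list of weighted points encodes both a combination of kernel sections and, through
    [eval_comb], the functional that it represents. Linear combinations become scaling and
    concatenation of lists. *)
Definition kernel_comb (s : seq (R * T)) : T -> R :=
  fun x => \sum_(p <- s) p.1 * K x p.2.

Definition eval_comb (s : seq (R * T)) (f : T -> R) : R :=
  \sum_(p <- s) p.1 * f p.2.

Lemma kernel_comb_rkhs s : H (kernel_comb s).
Proof.
elim: s => [|p s IHs].
  rewrite (_ : kernel_comb _ = fun=> 0); first exact: rkhs_zero HK.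
  by apply/funext => x; rewrite /kernel_comb big_nil.
rewrite (_ : kernel_comb _ = fun x => p.1 * K x p.2 + kernel_comb s x).
  exact: (rkhs_lin HK p.1 (rkhs_kernel HK p.2) IHs).
by apply/funext => x; rewrite /kernel_comb big_cons.
Qed.

Lemma fdot_kernel_comb f s : H f -> fdot H (kernel_comb s) f = eval_comb s f.
Proof.
move=> Hf; elim: s => [|p s IHs].
  rewrite /eval_comb big_nil -(mul0r (fdot H (fun=> 0) f)).
  rewrite -fdotZ//; last exact: rkhs_zero HK.
  by congr fdot; apply/funext => x; rewrite mul0r /kernel_comb big_nil.
rewrite /eval_comb big_cons -/(eval_comb s f) -IHs.
rewrite (rkhs_repr HK p.2 Hf) (rkhs_dotC HK Hf (rkhs_kernel HK _)).
rewrite -(rkhs_dot_lin HK)//; last 2 first.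
- exact: rkhs_kernel HK _.
- exact: kernel_comb_rkhs.
by congr fdot; apply/funext => x; rewrite /kernel_comb big_cons.
Qed.

Definition scale_comb (a : R) (s : seq (R * T)) := [seq (a * p.1, p.2) | p <- s].

Lemma eval_scale_comb a s t f :
  eval_comb (scale_comb a s ++ t) f = a * eval_comb s f + eval_comb t f.
Proof.
rewrite /eval_comb big_cat big_map mulr_sumr /=; congr (_ + _).
by apply: eq_bigr => p _; rewrite mulrA.
Qed.

Lemma kernel_scale_comb a s t :
  kernel_comb (scale_comb a s ++ t) =
  fun x => a * kernel_comb s x + kernel_comb t x.
Proof. by apply/funext => x; exact: eval_scale_comb. Qed.

Lemma kernel_combZ a s :
  kernel_comb (scale_comb a s) = fun x => a * kernel_comb s x.
Proof.
apply/funext => x; rewrite -[scale_comb _ _]cats0 kernel_scale_comb.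
by rewrite /kernel_comb big_nil addr0.
Qed.

Lemma eval_combZ a s f : eval_comb (scale_comb a s) f = a * eval_comb s f.
Proof. by rewrite -[scale_comb _ _]cats0 eval_scale_comb /eval_comb big_nil addr0. Qed.

(* The Riesz representation theorem for the functional sending the section of
   K at y to F y: its representer is F itself, and is the limit of a minimizing
   sequence of [fdot f f - 2 * F(f)] in the span of the sections of K. *)
Lemma rkhs_riesz (F : T -> R) (B : R) : 0 <= B -> (forall y, K y y = 1) ->
  (forall s, `|eval_comb s F| <= B * fnorm H (kernel_comb s)) ->
  [/\ H F, fnorm H F <= B
    & forall e : R, 0 < e ->
        exists s, fnorm H (fun x => kernel_comb s x - F x) < e].
Proof.
move=> B0 K1 FB; have Hc := kernel_comb_rkhs.
pose J s := fdot H (kernel_comb s) (kernel_comb s) - 2 * eval_comb s F.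
have J_ge s : - B ^+ 2 <= J s.
  have := FB s; rewrite ler_norml => /andP[_ h]; rewrite /J -sqr_fnorm//.
  have := sqr_ge0 (fnorm H (kernel_comb s) - B); rewrite sqrrB; lra.
have infJ : has_inf (range J).
  split; first by exists (J [::]); exists [::].
  by exists (- B ^+ 2) => _ [s _ <-].
have J_ge_inf s : inf (range J) <= J s by apply: ge_inf; [exact: infJ.2|exists s].
set i := inf (range J) in J_ge_inf *.
have JE s : J s = fdot H (kernel_comb s) (kernel_comb s) - 2 * eval_comb s F by [].
have /choice[s_ J_s] : forall n, exists s, J s < i + n.+1%:R^-1.
  move=> n; have n0 : 0 < n.+1%:R^-1 :> R by rewrite invr_gt0 ltr0n.
  by have [_ [s _ <-] ?] := inf_adherent n0 infJ; exists s.
(* Parallelogram identity: the square distance is 2 J(p) + 2 J(q) - 4 J(midpoint), and J at the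
   midpoint is at least the infimum. Hence a minimizing sequence is Cauchy. *)
have d_s p q : fdot H (fun x => kernel_comb (s_ p) x - kernel_comb (s_ q) x)
    (fun x => kernel_comb (s_ p) x - kernel_comb (s_ q) x) <
    2 * p.+1%:R^-1 + 2 * q.+1%:R^-1.
  rewrite fdot_sqB//.
  have := J_ge_inf (scale_comb 2^-1 (s_ p) ++ scale_comb 2^-1 (s_ q)).
  rewrite JE kernel_scale_comb eval_scale_comb eval_combZ fdot_sqD//.
  rewrite kernel_combZ fdotZ//; last exact: rkhsZ.
  have Hq := rkhsZ 2^-1 (Hc (s_ q)).
  rewrite (rkhs_dotC HK (Hc (s_ p)) Hq) (rkhs_dotC HK (Hc (s_ q)) Hq).
  rewrite !fdotZ// (rkhs_dotC HK (Hc (s_ q)) (Hc (s_ p))).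
  have := J_s p; have := J_s q; rewrite !JE; move: p.+1%:R^-1 q.+1%:R^-1 => ep eq; lra.
(* Write f for [kernel_comb (s_ n)]. Adding [F y - f y] times the section at y to f lowers J by
   exactly (F y - f y)^2, because [K y y = 1], and J cannot fall below its infimum. *)
have pt_s n y : (kernel_comb (s_ n) y - F y) ^+ 2 < n.+1%:R^-1.
  have := J_ge_inf (scale_comb (F y - kernel_comb (s_ n) y) [:: (1, y)] ++ s_ n).
  rewrite JE kernel_scale_comb eval_scale_comb fdot_sqD// !fdot_kernel_comb//.
  rewrite /eval_comb !big_seq1 /= [kernel_comb [:: _] _]/kernel_comb big_seq1 /= K1.
  rewrite -/(eval_comb (s_ n) F) -/(eval_comb (s_ n) (kernel_comb (s_ n))).
  have := J_s n; rewrite JE fdot_kernel_comb// => h1 h2.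
  move: h1 h2; move: n.+1%:R^-1 (F y) (kernel_comb (s_ n) y) => e a b; lra.
have inv_small (e : R) : 0 < e -> exists n0, forall n, (n0 <= n)%N -> n.+1%:R^-1 < e.
  move=> e0; exists (Num.truncn e^-1) => n n0n.
  rewrite invf_plt ?posrE ?ltr0n//.
  by apply: lt_le_trans (truncnS_gt _) _; rewrite ler_nat.
have [g Hg g_lim] : exists2 f, H f &
    fnorm H (fun x => kernel_comb (s_ n) x - f x) @[n --> \oo] --> (0 : R).
  apply: rkhs_complete HK _ _ _ => [n|e e0]; first exact: Hc.
  have [n0 hn0] := inv_small (e ^+ 2 / 4) ltac:(by rewrite divr_gt0 ?exprn_gt0).
  exists n0 => p q /hn0 hp /hn0 hq.
  rewrite -ltr_sqr ?nnegrE ?fnorm_ge0 ?ltW// sqr_fnorm; last exact: rkhsB.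
  by move: hp hq (d_s p q); move: p.+1%:R^-1 q.+1%:R^-1 => ep eq; lra.
have g_ev (e : R) : 0 < e -> exists n0, forall n, (n0 <= n)%N ->
    fnorm H (fun x => kernel_comb (s_ n) x - g x) < e.
  move=> e0; have /cvgrPdist_lt/(_ e e0)[n0 _ h] := g_lim.
  exists n0 => n /h /=; rewrite sub0r normrN ger0_norm//; exact: fnorm_ge0.
(* Norm convergence implies pointwise convergence, so the norm limit [g] must be the pointwise limit
   [F]. *)
have gF : g = F.
  apply/funext => y; apply/eqP; rewrite -subr_eq0 -normr_le0; apply/ler_addgt0Pr => e e0.
  have e20 : 0 < e / 2 by rewrite divr_gt0.
  have [n1 h1] := g_ev _ e20.
  have [n2 h2] := inv_small ((e / 2) ^+ 2) ltac:(by rewrite exprn_gt0).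
  have {}h1 := h1 (maxn n1 n2) (leq_maxl _ _).
  have {}h2 := h2 (maxn n1 n2) (leq_maxr _ _).
  have h3 := rkhs_point_le y (rkhsB (Hc (s_ (maxn n1 n2))) Hg).
  rewrite K1 sqrtr1 mulr1 in h3.
  have h4 := lt_trans (pt_s (maxn n1 n2) y) h2.
  have h5 : `|kernel_comb (s_ (maxn n1 n2)) y - F y| < e / 2.
    by rewrite -ltr_sqr ?nnegrE ?normr_ge0 ?ltW// real_normK ?num_real.
  rewrite add0r (_ : g y - F y = (kernel_comb (s_ (maxn n1 n2)) y - F y) -
    (kernel_comb (s_ (maxn n1 n2)) y - g y)); last by ring.
  by apply: le_trans (ler_normB _ _) _; lra.
rewrite -gF in FB *; split=> //; last first.
  by move=> e /g_ev[n0 h]; exists (s_ n0); exact: h.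
have [->|g_neq0] := eqVneq (fnorm H g) 0; first by [].
have g_gt0 : 0 < fnorm H g by rewrite lt_def g_neq0 fnorm_ge0.
(* If the combination is within t of [g], the square norm of [g] exceeds [eval_comb (s_ n0) g] by at
   most t |g|, and that value is at most B (t + |g|). The choice t < e / (B + |g|) keeps the total
   loss below e. *)
rewrite -(ler_pM2r g_gt0); apply/ler_addgt0Pr => e e0.
have Bg0 : 0 < B + fnorm H g by rewrite ltr_wpDl.
have [n0 /(_ n0 (leqnn _)) h] := g_ev _ (divr_gt0 e0 Bg0).
have h1 := fdot_le (rkhsB (Hc (s_ n0)) Hg) Hg.
have h2 := fnorm_le_add (Hc (s_ n0)) Hg.
have h3 := FB (s_ n0).
rewrite fdotB// fdot_kernel_comb// -sqr_fnorm// expr2 in h1.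
rewrite ltr_pdivlMr// in h.
move: h1 h3; rewrite !ler_norml => /andP[h1 _] /andP[_ h3].
have h4 := ler_wpM2l B0 h2; lra.
Qed.

End ReproducingKernelHilbertSpace.

(** * Worst-case optimal weights *)

Section OptimalWeights.
Variables (R : realType) (T : Type) (K : T -> T -> R).
Variables (H : inner_function_space R T) (HK : is_rkhs K H).
Variables (L : (T -> R) -> \bar R) (Lam : (T -> R) -> R) (B : R).
Hypothesis LE : forall f, H f -> L f = (Lam f)%:E.
Hypothesis Lam_linear : forall (a : R) f g, H f -> H g ->
  Lam (fun y => a * f y + g y) = a * Lam f + Lam g.
Hypothesis Lam_bounded : forall f, H f -> `|Lam f| <= B * fnorm H f.
Variables (N : nat) (x : 'I_N -> T).

Lemma cubature_linear w (a : R) f g :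
  cubature x w (fun y => a * f y + g y) = a * cubature x w f + cubature x w g.
Proof.
rewrite /cubature mulr_sumr -big_split /=; apply: eq_bigr => n _; ring.
Qed.

Let err w f := Lam f - cubature x w f.

Let err_linear w a f g : H f -> H g ->
  err w (fun y => a * f y + g y) = a * err w f + err w g.
Proof. by move=> Hf Hg; rewrite /err Lam_linear// cubature_linear; ring. Qed.

Let errZ w a f : H f -> err w (fun y => a * f y) = a * err w f.
Proof.
move=> Hf; pose z : T -> R := fun=> 0; have Hz : H z := rkhs_zero HK.
have := err_linear w 1 Hz Hz; rewrite mul1r (_ : (fun _ => _) = z); last first.
  by apply/funext => y; rewrite /z mulr0 addr0.
move=> z0; have := err_linear w a Hf Hz.
rewrite (_ : (fun _ => _) = fun y => a * f y); first by move=> ->; lra.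
by apply/funext => y; rewrite /z addr0.
Qed.

Let err_bounded w : exists C : R, forall f, H f -> `|err w f| <= C * fnorm H f.
Proof.
exists (B + \sum_n `|w ord0 n| * Num.sqrt (K (x n) (x n))) => f Hf.
rewrite mulrDl mulr_suml; apply: le_trans (ler_normB _ _) (lerD (Lam_bounded Hf) _).
apply: le_trans (ler_norm_sum _ _ _) (ler_sum _ _) => n _.
rewrite normrM -mulrA ler_wpM2l// mulrC; exact: rkhs_point_le.
Qed.

Lemma worst_case_error_le w r :
  (forall f, H f -> fnorm H f <= 1 -> `|Lam f - cubature x w f| <= r) ->
  (worst_case_error H L x w <= r%:E)%E.
Proof.
move=> wr; apply: ge_ereal_sup => _ [f [Hf f1] <-].
by rewrite LE// lee_fin wr.
Qed.

(** The supremum over the unit ball is an operator norm: it is finite because [Lam] and the point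
    evaluations are bounded, and normalizing [f] extends the estimate to all of [H]. *)
Lemma worst_case_error_fin w : exists r : R,
  [/\ 0 <= r, worst_case_error H L x w = r%:E
    & forall f, H f -> `|Lam f - cubature x w f| <= r * fnorm H f].
Proof.
have [C errC] := err_bounded w.
have ge f : H f -> fnorm H f <= 1 ->
    ((`|err w f|)%:E <= worst_case_error H L x w)%E.
  move=> Hf f1; apply: ereal_sup_ubound; exists f; first by split.
  by rewrite LE.
have Hz := rkhs_zero HK.
have z0 : fnorm H (fun=> 0) = 0.
  by rewrite (_ : (fun=> 0) = fun y => 0 * (fun=> 0) y) ?(fnormZ HK)// ?normr0 ?mul0r//;
     apply/funext => y; rewrite mul0r.
have E_ge0 := ge _ Hz; rewrite z0 ler01 in E_ge0; have {}E_ge0 := E_ge0 isT.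
(* [C] is not known to be nonnegative, hence the absolute value. *)
have E_le : (worst_case_error H L x w <= (`|C|)%:E)%E.
  apply: worst_case_error_le => f Hf f1; apply: le_trans (errC f Hf) _.
  apply: le_trans (ler_norm _) _; rewrite normrM (ger0_norm (fnorm_ge0 _ f)).
  by rewrite ler_piMr.
case: (worst_case_error H L x w) E_ge0 E_le ge => [r| |]//= E_ge0 _ ge.
exists r; split=> [||f Hf]//; first by rewrite (le_trans (normr_ge0 _) E_ge0).
 have [f0|f_neq0] := eqVneq (fnorm H f) 0.
  by have := errC f Hf; rewrite f0 !mulr0.
have f_gt0 : 0 < fnorm H f by rewrite lt_def f_neq0 fnorm_ge0.
have := ge _ (rkhsZ HK (fnorm H f)^-1 Hf).
rewrite (fnormZ HK)// normfV gtr0_norm// mulVf// lexx lee_fin errZ// => /(_ isT).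
by rewrite normrM normfV (gtr0_norm f_gt0) mulrC ler_pdivrMr.
Qed.

Let comb (c : 'rV[R]_N) : T -> R := fun y => \sum_n c ord0 n * K y (x n).

Let combE c : comb c = kernel_comb K [seq (c ord0 n, x n) | n <- enum 'I_N].
Proof. by apply/funext => y; rewrite /kernel_comb big_map big_enum. Qed.

Let comb_rkhs c : H (comb c).
Proof. by rewrite combE; exact: kernel_comb_rkhs HK _. Qed.

Let fdot_comb c f : H f -> fdot H (comb c) f = cubature x c f.
Proof.
by move=> Hf; rewrite combE (fdot_kernel_comb HK)// /eval_comb big_map big_enum.
Qed.

(* Splitting f orthogonally along the span of the kernel sections at the nodes,
   the error on the orthogonal complement does not depend on the weights, and
   the optimal weights are those with zero error on the span. *)
Lemma optimal_weights_unique :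
  (forall c : 'rV[R]_N, cubature x c (comb c) = 0 -> c = 0) ->
  exists w, unique (worst_case_optimal H L x) w.
Proof.
move=> comb_inj; pose G := \matrix_(i < N, j < N) K (x i) (x j).
have rowG c n : (c *m G) ord0 n = comb c (x n).
  by rewrite mxE; apply: eq_bigr => i _; rewrite mxE (kernelC HK).
(* A row vector annihilated by [G] gives a combination that vanishes at every node, to which
   [comb_inj] applies. *)
have G_unit : G \in unitmx.
  rewrite -row_free_unit -kermx_eq0; apply/eqP/row_matrixP => i.
  rewrite row0; apply: comb_inj; apply: big1 => n _.
  by rewrite -rowG -row_mul mulmx_ker row0 [X in _ * X]mxE mulr0.
pose w := \row_n Lam (fun y => K y (x n)) *m invmx G.
have Hx n := rkhs_kernel HK (x n).
have w_node n : err w (fun y => K y (x n)) = 0.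
  apply/eqP; rewrite subr_eq0; apply/eqP.
  transitivity ((w *m G) ord0 n); first by rewrite mulmxKV// mxE.
  by rewrite mxE; apply: eq_bigr => i _; rewrite [X in _ * X]mxE.
have w_span c : err w (comb c) = 0.
  rewrite /comb; elim: index_enum => [|n s IHs].
    rewrite (_ : (fun _ => _) = fun y => 0 * (fun=> 0) y); last first.
      by apply/funext => y; rewrite big_nil mul0r.
    by rewrite errZ ?mul0r//; exact: rkhs_zero HK.
  rewrite (_ : (fun _ => _) =
      fun y => c ord0 n * K y (x n) + \sum_(k <- s) c ord0 k * K y (x k)).
    rewrite err_linear ?w_node ?IHs ?mulr0 ?addr0//.
    have := kernel_comb_rkhs HK [seq (c ord0 n, x n) | n <- s].
    by congr (fcarrier H _); apply/funext => y; rewrite /kernel_comb big_map.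
  by apply/funext => y; rewrite big_cons.
(* [u] is [f] minus its kernel interpolant at the nodes. It vanishes at the nodes, which is
   orthogonality to the span, and [w] has no error on the interpolant. *)
have split f : H f -> exists u, [/\ H u, fnorm H u <= fnorm H f,
    forall v, cubature x v u = 0, err w f = err w u &
    forall c, fdot H (comb c) u = 0].
  move=> Hf; pose c := \row_n f (x n) *m invmx G.
  have Hu := rkhsB HK Hf (comb_rkhs c).
  have u0 n : f (x n) - comb c (x n) = 0.
    by rewrite -rowG mulmxKV// mxE subrr.
  have Qu v : cubature x v (fun y => f y - comb c y) = 0.
    by apply: big1 => n _; rewrite u0 mulr0.
  have f_u : f = fun y => 1 * (f y - comb c y) + comb c y.
    by apply/funext => y; rewrite mul1r subrK.
  exists (fun y => f y - comb c y); split => //.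
  - rewrite -ler_sqr ?nnegrE ?fnorm_ge0// !(sqr_fnorm HK)// {3 4}f_u.
    rewrite (fdot_sqD HK)// (rkhs_dotC HK Hu (comb_rkhs c)) fdot_comb// Qu.
    by have := rkhs_dot_ge0 HK (comb_rkhs c); lra.
  - by rewrite {1}f_u err_linear// w_span mul1r addr0.
  - by move=> c'; rewrite fdot_comb.
(* On [u] every rule makes the same error [Lam u], so no rule can do better than [w]. *)
have w_opt : worst_case_optimal H L x w.
  move=> v; have [r [r0 -> r_err]] := worst_case_error_fin v.
  apply: worst_case_error_le => f Hf f1.
  have [u [Hu uf Qu fu _]] := split f Hf; rewrite -/(err w f) fu.
  have := r_err u Hu; rewrite /err !Qu => h; apply: le_trans h _.
  by rewrite ler_piMr// (le_trans uf).
exists w; split=> // v v_opt; apply/eqP; rewrite -subr_eq0; apply/eqP/comb_inj.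
(* The representer of [w - v] serves as a test function: [w] is exact on it, so the error of [v] on
   it is its square norm. *)
pose h := comb (w - v); have Hh : H h := comb_rkhs _.
have hh : fdot H h h = cubature x (w - v) h by rewrite fdot_comb.
have err_v_h : err v h = fdot H h h.
  have /eqP := w_span (w - v); rewrite subr_eq0 -/h => /eqP Lam_h.
  rewrite hh /err Lam_h /cubature -sumrB; apply: eq_bigr => n _; rewrite !mxE; ring.
apply/eqP; rewrite -/h -hh eq_le (rkhs_dot_ge0 HK)// andbT leNgt; apply/negP => hh_gt0.
have [r [r0 Ev r_err]] := worst_case_error_fin v.
have Ew : worst_case_error H L x w = r%:E.
  by apply/eqP; rewrite eq_le -Ev w_opt v_opt.
(* v is tested on [s * u + h], where h represents the difference of the two
   rules and is orthogonal to u. *)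
have gap f : H f -> fnorm H f <= 1 -> r * `|err w f| < r ^+ 2 - fdot H h h / 2.
  move=> Hf f1; have [u [Hu uf Qu -> u_comb]] := split f Hf.
  pose s := if 0 <= err w u then r else - r.
  have s2 : s ^+ 2 = r ^+ 2 by rewrite /s; case: ifP; rewrite ?sqrrN.
  have s_err : s * err w u = r * `|err w u|.
    rewrite /s; case: ifP => [/ger0_norm->//|/negbT].
    by rewrite -ltNge => /ltr0_norm->; rewrite mulrN mulNr.
  have Hsu := rkhs_lin HK s Hu Hh.
  have := r_err _ Hsu; rewrite -/(err v _) err_linear// err_v_h.
  rewrite -[err v u]/(Lam u - cubature x v u) Qu -(Qu w) -/(err w u) s_err.
  rewrite ger0_norm; last by rewrite addr_ge0 ?mulr_ge0// ltW.
  rewrite -ler_sqr ?nnegrE ?mulr_ge0 ?addr_ge0 ?fnorm_ge0//; last 2 first.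
  - by rewrite mulr_ge0.
  - by rewrite ltW.
  rewrite exprMn (sqr_fnorm HK)// (fdot_sqD HK)// (rkhs_dotC HK Hu Hh) u_comb s2.
  rewrite mulr0 addr0 -(sqr_fnorm HK Hu) => le1.
  have le2 : r ^+ 2 * (r ^+ 2 * fnorm H u ^+ 2 + fdot H h h) <=
      r ^+ 2 * (r ^+ 2 + fdot H h h).
    rewrite ler_wpM2l ?sqr_ge0// lerD2r ler_piMr ?sqr_ge0// exprn_ile1 ?fnorm_ge0//.
    exact: le_trans f1.
  (* Completing the square: (r^2 + |h|^2 / 2)^2 exceeds r^2 (r^2 + |h|^2) by (|h|^2 / 2)^2, which is
     where strictness comes from. *)
  have rh0 : 0 <= r ^+ 2 + fdot H h h / 2 by rewrite addr_ge0 ?sqr_ge0// divr_ge0 ?ltW.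
  rewrite -(ltrD2r (fdot H h h)).
  rewrite (_ : r ^+ 2 - _ + _ = r ^+ 2 + fdot H h h / 2); last by lra.
  rewrite -ltr_sqr ?nnegrE ?addr_ge0 ?mulr_ge0 ?(ltW hh_gt0)//.
  apply: (le_lt_trans (le_trans le1 le2)); rewrite -subr_gt0.
  rewrite (_ : _ - _ = (fdot H h h / 2) ^+ 2); last by field.
  by rewrite exprn_gt0// divr_gt0.
have z1 : fnorm H (fun=> 0) <= 1.
  rewrite (_ : (fun=> 0) = fun y => 0 * (fun=> 0) y).
    by rewrite (fnormZ HK) ?normr0 ?mul0r//; exact: rkhs_zero HK.
  by apply/funext => y; rewrite mul0r.
have r_gt0 : 0 < r.
  rewrite lt_def r0 andbT; apply/eqP => r_eq0.
  have := gap _ (rkhs_zero HK) z1; rewrite r_eq0; lra.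
(* Dividing [gap] by [r] bounds the error of [w] strictly below [r], against [Ew]. *)
suff : (worst_case_error H L x w <= (r - fdot H h h / (2 * r))%:E)%E.
  rewrite Ew lee_fin leNgt => /negP; apply.
  by rewrite ltrBlDr ltrDl divr_gt0// mulr_gt0.
apply: worst_case_error_le => f Hf f1; rewrite -(ler_pM2l r_gt0).
apply: le_trans (ltW (gap f Hf f1)) _.
rewrite le_eqVlt; apply/orP; left; apply/eqP; field; exact: lt0r_neq0.
Qed.

End OptimalWeights.

(** * Positive functionals *)

Section PositiveFunctional.
Variables (R : realType) (T : topologicalType) (L : (T -> R) -> \bar R).
Hypothesis PL : positive_functional L.

(** The class on which [L], read through [fine], is a real-valued linear functional. *)
Definition dominated (f : T -> R) :=
  continuous f /\ (L (fun y => `|f y|)%R < +oo)%E.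

Lemma posf_le (f g : T -> R) : continuous f -> continuous g ->
  (forall y, 0 <= f y) -> (forall y, f y <= g y) -> (L f <= L g)%E.
Proof.
move=> cf cg f0 fg.
have cd : continuous (fun y => g y - f y).
  by move=> y; apply: cvgB; [exact: cg|exact: cf].
have d0 y : 0 <= g y - f y by rewrite subr_ge0.
rewrite (_ : g = fun y => f y + (g y - f y)).
  by rewrite (posf_add PL)//; apply: leeDl; exact: (posf_ge0 PL).
by apply/funext => y; rewrite addrC subrK.
Qed.

Let norm_ge0 (h : T -> R) y : 0 <= `|h y|.
Proof. exact: normr_ge0. Qed.

Lemma dominated_lin (a : R) f g :
  dominated f -> dominated g -> dominated (fun y => a * f y + g y).
Proof.
move=> [cf Lf] [cg Lg].
have cnf : continuous (fun y => `|f y|) by move=> y; apply: cvg_norm; exact: cf.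
have cng : continuous (fun y => `|g y|) by move=> y; apply: cvg_norm; exact: cg.
have csum b (f' g' : T -> R) : continuous f' -> continuous g' ->
    continuous (fun y => b * f' y + g' y).
  move=> cf' cg' y; apply: cvgD; last exact: cg'.
  by apply: cvgM; [exact: cvg_cst|exact: cf'].
split; first exact: csum.
have normr_id_fun (h : T -> R) : (fun y => `| `|h y| |) = fun y => `|h y|.
  by apply/funext => y; rewrite normr_id.
apply: (@le_lt_trans _ _ (L (fun y => `|a| * `|f y| + `|g y|))).
- apply: posf_le => [y||y|y]//; first by apply: cvg_norm; exact: (csum _ _ _ cf cg).
  + exact: csum.
  + by rewrite -normrM ler_normD.
rewrite (posf_linear PL)//; rewrite ?normr_id_fun//.
have := posf_ge0 PL cnf (norm_ge0 f).
have := posf_ge0 PL cng (norm_ge0 g).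
move: Lf Lg; case: (L _) => [r| |]//; case: (L _) => [s| |]// _ _ _ _.
by rewrite -EFinM -EFinD ltry.
Qed.

(** Additivity alone would allow the value +oo at 0. A dominated [f] gives a finite L[|f|] that can
    be cancelled in L[|f|] + L[0] = L[|f|]. *)
Lemma posf0 f : dominated f -> L (fun=> 0) = 0%E.
Proof.
move=> [cf Lf]; have cnf : continuous (fun y => `|f y|).
  by move=> y; apply: cvg_norm; exact: cf.
have c0 : continuous ((fun=> 0) : T -> R) by move=> y; exact: cvg_cst.
have p0 (y : T) : 0 <= (0 : R) by [].
have := posf_add PL cnf c0 (fun y => normr_ge0 _) p0.
rewrite (_ : (fun y => _ + _) = fun y => `|f y|).
  have := posf_ge0 PL cnf (norm_ge0 f).
  have := posf_ge0 PL c0 p0.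
  move: Lf; case: (L _) => [r| |]//; case: (L _) => [s| |]// _ _ _ [h].
  by congr _%:E; apply: (addrI r); rewrite addr0.
by apply/funext => y; rewrite addr0.
Qed.

(** Linearity applied to -f + f gives - L f + L f = 0, which fails in the extended reals when [L f]
    is infinite. *)
Lemma dominated_fin f : dominated f -> L f = (fine (L f))%:E.
Proof.
move=> Df; have [cf Lf] := Df; have := posf_linear PL (-1) cf cf Lf Lf.
rewrite (_ : (fun y => _) = fun=> 0); last first.
  by apply/funext => y; rewrite mulN1r addNr.
by rewrite (posf0 Df) mulN1e; case: (L f).
Qed.

Lemma fine_posf_linear (a : R) f g : dominated f -> dominated g ->
  fine (L (fun y => a * f y + g y)) = a * fine (L f) + fine (L g).
Proof.
move=> Df Dg; rewrite (posf_linear PL a Df.1 Dg.1 Df.2 Dg.2).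
by rewrite (dominated_fin Df) (dominated_fin Dg).
Qed.

(** Both bounds are positivity of [L], applied to g + f and to g - f. *)
Lemma dominated_le (f g : T -> R) : continuous f -> dominated g ->
  (forall y, `|f y| <= g y) -> dominated f /\ `|fine (L f)| <= fine (L g).
Proof.
move=> cf Dg fg; have [cg Lg] := Dg.
have g0 y : 0 <= g y by exact: le_trans (fg y).
have gn : (fun y => `|g y|) = g by apply/funext => y; rewrite ger0_norm.
have cnf : continuous (fun y => `|f y|) by move=> y; apply: cvg_norm; exact: cf.
have Df : dominated f.
  by split=> //; apply: le_lt_trans Lg; rewrite gn; exact: posf_le.
split=> //; rewrite ler_norml; apply/andP; split.
- suff : 0 <= 1 * fine (L f) + fine (L g) by lra.
  rewrite -fine_posf_linear// fine_ge0// (posf_ge0 PL)//.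
  + exact: (dominated_lin 1 Df Dg).1.
  + by move=> y; have := fg y; rewrite ler_norml => /andP[]; lra.
- suff : 0 <= -1 * fine (L f) + fine (L g) by lra.
  rewrite -fine_posf_linear// fine_ge0// (posf_ge0 PL)//.
  + exact: (dominated_lin (-1) Df Dg).1.
  + by move=> y; have := fg y; rewrite ler_norml => /andP[]; lra.
Qed.

Lemma dominated_sum (I : Type) (r : seq I) (c : I -> R) (F : I -> T -> R) :
  dominated (fun=> 0) -> (forall i, dominated (F i)) ->
  dominated (fun y => \sum_(i <- r) c i * F i y) /\
  fine (L (fun y => \sum_(i <- r) c i * F i y)) =
  \sum_(i <- r) c i * fine (L (F i)).
Proof.
move=> D0 DF; elim: r => [|i r [IH1 IH2]].
  rewrite big_nil (_ : (fun _ => _) = fun=> 0) ?(posf0 D0)//.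
  by apply/funext => y; rewrite big_nil.
rewrite big_cons (_ : (fun _ => _) =
    fun y => c i * F i y + \sum_(i <- r) c i * F i y); last first.
  by apply/funext => y; rewrite big_cons.
by rewrite -IH2 fine_posf_linear//; split=> //; exact: dominated_lin.
Qed.

Lemma dominated_norm f : dominated f -> dominated (fun y => `|f y|).
Proof.
move=> [cf Lf]; split; first by move=> y; apply: cvg_norm; exact: cf.
rewrite (_ : (fun y => _) = fun y => `|f y|)//.
by apply/funext => y; rewrite normr_id.
Qed.

End PositiveFunctional.

(** By Cauchy-Schwarz (f y - f z)^2 is at most (2 - 2 K z y) |f|^2, and K z y tends to K y y = 1 as
    z tends to y. *)
Lemma rkhs_continuous (R : realType) (T : topologicalType) (K : T -> T -> R)
    (H : inner_function_space R T) (HK : is_rkhs K H) :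
  (forall y, K y y = 1) -> (forall y, continuous (fun z => K z y)) ->
  forall f : T -> R, H f -> continuous f.
Proof.
move=> K1 K_cont f Hf y; apply/cvgrPdist_lt => e e0.
have k0 : 0 < 2 * (fnorm H f ^+ 2 + 1) by rewrite mulr_gt0// ltr_wpDl ?sqr_ge0.
have Kc : K z y @[z --> y] --> (1 : R).
  by rewrite -(K1 y); exact: K_cont.
have /cvgrPdist_lt/(_ _ (divr_gt0 (exprn_gt0 2 e0) k0)) := Kc.
apply: filterS => z hz.
have Ky := rkhs_kernel HK y; have Kz := rkhs_kernel HK z.
have := fdot_le HK (rkhsB HK Ky Kz) Hf.
rewrite (fdotB HK)// (rkhs_dotC HK Ky Hf) (rkhs_dotC HK Kz Hf).
rewrite -(rkhs_repr HK y Hf) -(rkhs_repr HK z Hf) => h.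
rewrite -ltr_sqr ?nnegrE ?(ltW e0)//.
apply: (@le_lt_trans _ _ ((2 - 2 * K z y) * fnorm H f ^+ 2)).
  rewrite -ler_sqr ?nnegrE ?mulr_ge0 ?fnorm_ge0// in h.
  apply: le_trans h _; rewrite exprMn (sqr_fnorm HK (rkhsB HK Ky Kz)).
  rewrite (fdot_sqB HK)// -!(rkhs_repr HK)// !K1.
  by rewrite le_eqVlt; apply/orP; left; apply/eqP; ring.
rewrite ltr_pdivlMr// in hz; apply: le_lt_trans hz.
have D0 : 0 <= `|1 - K z y| := normr_ge0 _.
have hD := ler_wpM2r (sqr_ge0 (fnorm H f)) (ler_norm (1 - K z y)).
lra.
Qed.

(** * Expansion of the Gaussian kernel *)

Section MultiIndexBox.
Variable d : nat.

Definition box_index n (t : {ffun 'I_d -> 'I_n.+1}) : multi_index d :=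
  [ffun i => val (t i)].

(** Cubes of multi-indices, instead of balls for the total degree, make truncated expansions factor
    into one-dimensional partial sums. *)
Definition box n : seq (multi_index d) :=
  [seq box_index t | t : {ffun 'I_d -> 'I_n.+1}].

Lemma box_index_inj n : injective (@box_index n).
Proof.
move=> s t /ffunP st; apply/ffunP => i; apply/val_inj.
by have := st i; rewrite !ffunE.
Qed.

Lemma box_uniq n : uniq (box n).
Proof. by rewrite map_inj_uniq ?enum_uniq//; exact: box_index_inj. Qed.

Lemma mem_box n (al : multi_index d) : (al \in box n) = [forall i, (al i <= n)%N].
Proof.
apply/mapP/forallP => [[t _ ->] i|aln]; first by rewrite ffunE -ltnS ltn_ord.
exists [ffun i => inord (al i)]; first by rewrite mem_enum.
by apply/ffunP => i; rewrite !ffunE /= inordK// ltnS aln.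
Qed.

Lemma mem_box_mabs (al : multi_index d) n : (mabs al <= n)%N -> al \in box n.
Proof.
move=> aln; rewrite mem_box; apply/forallP => i; apply: leq_trans aln.
by rewrite /mabs (bigD1 i)//= leq_addr.
Qed.

Lemma sub_box n p : (n <= p)%N -> {subset box n <= box p}.
Proof.
move=> np al; rewrite !mem_box => /forallP aln; apply/forallP => i.
exact: leq_trans (aln i) np.
Qed.

Lemma big_box_split (R : nmodType) n p (F : multi_index d -> R) : (n <= p)%N ->
  \sum_(al <- box p) F al =
  \sum_(al <- box n) F al + \sum_(al <- box p | al \notin box n) F al.
Proof.
move=> np; rewrite (bigID (mem (box n)))/=; congr (_ + _).
rewrite -big_filter; apply: perm_big; apply: uniq_perm => [||al].
- by rewrite filter_uniq// box_uniq.
- exact: box_uniq.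
- rewrite mem_filter; case: (boolP (al \in box n)) => //= aln.
  by rewrite (sub_box np).
Qed.

Lemma sum_box_prod (R : comPzRingType) n (F : 'I_d -> nat -> R) :
  \sum_(al <- box n) \prod_i F i (al i) = \prod_i \sum_(k < n.+1) F i k.
Proof.
rewrite bigA_distr_bigA big_map big_enum /=; apply: eq_bigr => t _.
by apply: eq_bigr => i _; rewrite ffunE.
Qed.

End MultiIndexBox.

(** Induction on the list. The new cross terms require 2 a b S <= a^2 B + b^2 A, which follows by
    squaring, since S^2 <= A B by induction. *)
Lemma sum_cauchy_schwarz (R : realDomainType) (I : Type) (r : seq I) (P : pred I)
    (a b : I -> R) :
  (\sum_(i <- r | P i) a i * b i) ^+ 2 <=
  (\sum_(i <- r | P i) a i ^+ 2) * (\sum_(i <- r | P i) b i ^+ 2).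
Proof.
elim: r => [|i r]; first by rewrite !big_nil expr0n mulr0.
rewrite !big_cons; case: ifP => // _.
have: 0 <= \sum_(j <- r | P j) a j ^+ 2 by apply: sumr_ge0 => j _; exact: sqr_ge0.
have: 0 <= \sum_(j <- r | P j) b j ^+ 2 by apply: sumr_ge0 => j _; exact: sqr_ge0.
move: (\sum_(j <- r | P j) _) (\sum_(j <- r | P j) _) (\sum_(j <- r | P j) _).
move=> S A B B0 A0 SAB; move: (a i) (b i) => {}a {}b.
suff : 2 * (a * b * S) <= a ^+ 2 * B + b ^+ 2 * A by lra.
have rhs0 : 0 <= a ^+ 2 * B + b ^+ 2 * A by rewrite addr_ge0// mulr_ge0 ?sqr_ge0.
rewrite (le_trans (ler_norm _))// -ler_sqr ?nnegrE ?normr_ge0//.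
rewrite real_normK ?num_real// -subr_ge0.
rewrite (_ : _ - _ = (a ^+ 2 * B - b ^+ 2 * A) ^+ 2 +
  4 * (a * b) ^+ 2 * (A * B - S ^+ 2)); last by ring.
by rewrite addr_ge0 ?sqr_ge0// mulr_ge0 ?subr_ge0// mulr_ge0// sqr_ge0.
Qed.

Section GaussianFeatures.
Variables (R : realType) (d : nat) (l : R).
Hypothesis l_gt0 : 0 < l.

Definition gauss (x y : 'rV[R]_d) : R :=
  expR (- sqnorm2 (x - y) / (2 * l ^+ 2)).

(* The components of a feature map of the Gaussian kernel:
   [gauss x y] is the sum of [psi al x * psi al y] over all multi-indices. *)
Definition psi (al : multi_index d) (x : 'rV[R]_d) : R :=
  phi l al x / (l ^+ mabs al * Num.sqrt (mfact al)%:R).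

Definition gauss_trunc n (x y : 'rV[R]_d) : R :=
  \sum_(al <- box d n) psi al x * psi al y.

Lemma mfact_gt0 (al : multi_index d) : 0 < (mfact al)%:R :> R.
Proof. by rewrite ltr0n prodn_gt0// => i; exact: fact_gt0. Qed.

(** Powers of [l], factorials and monomials are all products over the coordinates, so a term of the
    expansion is a product of terms of exponential series. *)
Lemma psi_psi al x y : psi al x * psi al y =
  expR (- sqnorm2 x / (2 * l ^+ 2)) * expR (- sqnorm2 y / (2 * l ^+ 2)) *
  \prod_i exp_coeff (x ord0 i * y ord0 i / l ^+ 2) (al i).
Proof.
rewrite (eq_bigr (fun i => (x ord0 i ^+ al i * y ord0 i ^+ al i) /
    ((l ^+ 2) ^+ al i * (al i)`!%:R))); last first.
  by move=> i _; rewrite /exp_coeff /= expr_div_n exprMn invfM mulrA.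
rewrite prodf_div !big_split /= prodrXr -natr_prod /psi /phi.
rewrite -/(monom al x) -/(monom al y) -/(mabs al) -/(mfact al).
rewrite -exprM mulnC exprM.
have f0 := mfact_gt0 al; set s := Num.sqrt _.
have s0 : s != 0 by rewrite gt_eqF// sqrtr_gt0.
rewrite (_ : (mfact al)%:R = s ^+ 2); last by rewrite sqr_sqrtr ?ltW.
have l0 : l ^+ mabs al != 0 by rewrite expf_neq0// gt_eqF.
by field; rewrite l0 s0.
Qed.

Lemma gauss_truncE n x y : gauss_trunc n x y =
  expR (- sqnorm2 x / (2 * l ^+ 2)) * expR (- sqnorm2 y / (2 * l ^+ 2)) *
  \prod_i series (exp_coeff (x ord0 i * y ord0 i / l ^+ 2)) n.+1.
Proof.
rewrite /gauss_trunc; rewrite (eq_bigr _ (fun al _ => psi_psi al x y)).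
rewrite -mulr_sumr; congr (_ * _).
rewrite (sum_box_prod n (fun i => exp_coeff (x ord0 i * y ord0 i / l ^+ 2))).
by apply: eq_bigr => i _; rewrite /series /= big_mkord.
Qed.

Lemma gaussE x y : gauss x y =
  expR (- sqnorm2 x / (2 * l ^+ 2)) * expR (- sqnorm2 y / (2 * l ^+ 2)) *
  \prod_i expR (x ord0 i * y ord0 i / l ^+ 2).
Proof.
rewrite -expR_sum -!expRD; congr expR.
rewrite -mulr_suml /sqnorm2 (eq_bigr (fun i => x ord0 i ^+ 2 + y ord0 i ^+ 2 -
   2 * (x ord0 i * y ord0 i))); last by move=> i _; rewrite !mxE; ring.
rewrite sumrB big_split /= -mulr_sumr; field; exact: lt0r_neq0.
Qed.

Lemma gauss_trunc_cvg x y : gauss_trunc n x y @[n --> \oo] --> gauss x y.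
Proof.
rewrite gaussE; under eq_fun do rewrite gauss_truncE.
apply: cvgM; first exact: cvg_cst.
apply: cvg_big => [|i _]; first exact: mul_continuous.
have := is_cvg_series_exp_coeff (x ord0 i * y ord0 i / l ^+ 2).
move=> /cvg_ex[e he]; rewrite /expR (cvg_lim _ he)//.
by move: he; rewrite -cvg_shiftS.
Qed.

Lemma gauss1 x : gauss x x = 1.
Proof.
rewrite /gauss subrr /sqnorm2 big1 ?oppr0 ?mul0r ?expR0// => i _.
by rewrite mxE expr0n.
Qed.

Lemma gauss_trunc_diag_nondecreasing x :
  nondecreasing_seq (fun n => gauss_trunc n x x).
Proof.
move=> n p np; rewrite /gauss_trunc (big_box_split _ np) lerDl.
by apply: sumr_ge0 => al _; rewrite -expr2 sqr_ge0.
Qed.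

Lemma gauss_trunc_diag_le1 n x : gauss_trunc n x x <= 1.
Proof.
have h := @gauss_trunc_cvg x x; rewrite -(gauss1 x) -(cvg_lim _ h)//.
apply: (nondecreasing_cvgn_le (@gauss_trunc_diag_nondecreasing x)).
exact: cvgP h.
Qed.

(** Cauchy-Schwarz on the remainder of the series: its diagonal part at [x] is at most 1 and its
    diagonal part at [y] is the right-hand side. The bound is free of [x], so convergence at the
    single point [y] becomes uniform in [x]. *)
Lemma gauss_trunc_err n x y :
  (gauss x y - gauss_trunc n x y) ^+ 2 <= 1 - gauss_trunc n y y.
Proof.
have h : (gauss_trunc p x y - gauss_trunc n x y) ^+ 2 @[p --> \oo] -->
    (gauss x y - gauss_trunc n x y) ^+ 2.
  by under eq_fun do rewrite expr2; rewrite expr2; apply: cvgM;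
    apply: cvgB (cvg_cst _); exact: gauss_trunc_cvg.
apply: (cvgr_to_le h).
near=> p; have np : (n <= p)%N by near: p; exact: nbhs_infty_ge.
rewrite /gauss_trunc (big_box_split _ np) addrAC subrr add0r.
apply: le_trans (sum_cauchy_schwarz _ _ _ _) _; rewrite -[leRHS]mul1r.
have le1 z : \sum_(al <- box d p | al \notin box d n) psi al z ^+ 2 <=
    1 - gauss_trunc n z z.
  rewrite lerBrDl; apply: le_trans (gauss_trunc_diag_le1 p z).
  by rewrite /gauss_trunc (big_box_split _ np).
apply: ler_pM; rewrite ?le1//; try by apply: sumr_ge0 => al _; exact: sqr_ge0.
apply: le_trans (le1 x) _; rewrite gerBl /gauss_trunc.
by apply: sumr_ge0 => al _; rewrite -expr2 sqr_ge0.
Unshelve. all: by end_near. Qed.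

Lemma gauss_trunc_unif y (e : R) : 0 < e -> exists n0, forall n, (n0 <= n)%N ->
  forall x, `|gauss x y - gauss_trunc n x y| <= e.
Proof.
move=> e0; have e20 : 0 < e ^+ 2 by rewrite exprn_gt0.
have /cvgrPdist_lt/(_ _ e20)[n0 _ h] := @gauss_trunc_cvg y y.
exists n0 => n /h /=; rewrite gauss1 => hn x.
rewrite -ler_sqr ?nnegrE ?(ltW e0)// real_normK ?num_real//.
apply: le_trans (gauss_trunc_err n x y) _.
exact: le_trans (ler_norm _) (ltW hn).
Qed.

Variables (T : Type) (v : T -> 'rV[R]_d).
Let K y z := gauss (v y) (v z).

(** Each section of the kernel is a uniform limit of its truncations; summing over the weighted
    points of [s] collects the coefficient [eval_comb s (psi al \o v)] in front of each feature. *)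
Lemma kernel_comb_psi_approx s (e : R) : 0 < e ->
  exists n0, forall n, (n0 <= n)%N -> forall y,
  `|kernel_comb K s y -
    \sum_(al <- box d n) eval_comb s (psi al \o v) * psi al (v y)| <= e.
Proof.
elim: s e => [|p s IHs] e e0.
  exists 0 => n _ y; rewrite /kernel_comb big_nil big1 ?subrr ?normr0 ?ltW// => al _.
  by rewrite /eval_comb big_nil mul0r.
have e20 : 0 < e / 2 by rewrite divr_gt0.
have [n1 h1] := IHs _ e20.
have p0 : 0 < `|p.1| + 1 by rewrite ltr_wpDl.
have [n2 h2] := gauss_trunc_unif (v p.2) (divr_gt0 e20 p0).
exists (maxn n1 n2) => n; rewrite geq_max => /andP[/h1{}h1 /h2{}h2] y.
rewrite (_ : _ - _ = p.1 * (gauss (v y) (v p.2) - gauss_trunc n (v y) (v p.2)) +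
   (kernel_comb K s y - \sum_(al <- box d n) eval_comb s (psi al \o v) * psi al (v y))).
  apply: le_trans (ler_normD _ _) _; rewrite [leRHS](splitr e).
  apply: lerD (h1 _); rewrite normrM -(divfK (lt0r_neq0 p0) (e / 2)) mulrC.
  by apply: ler_pM (h2 _) _ => //; rewrite lerDl.
rewrite /kernel_comb big_cons mulrBr /gauss_trunc [p.1 * (\sum_(_ <- _) _)]mulr_sumr.
rewrite [RHS]addrACA -opprD -big_split /=; congr (_ - _).
by apply: eq_bigr => al _; rewrite /eval_comb big_cons /=; ring.
Qed.

(** Bessel's inequality: the right-hand side is the quadratic form of the kernel, which is the limit
    of the nondecreasing sums on the left as the box grows. *)
Lemma sum_sqr_eval_psi_le n s :
  \sum_(al <- box d n) eval_comb s (psi al \o v) ^+ 2 <=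
  eval_comb s (kernel_comb K s).
Proof.
pose A k := \sum_(al <- box d k) eval_comb s (psi al \o v) ^+ 2.
have A_nd : nondecreasing_seq A.
  move=> k p kp; rewrite /A (big_box_split _ kp) lerDl.
  by apply: sumr_ge0 => al _; rewrite sqr_ge0.
have AE k : A k = \sum_(p <- s) \sum_(q <- s) p.1 * q.1 * gauss_trunc k (v p.2) (v q.2).
  rewrite /A; under eq_bigr do rewrite expr2 /eval_comb mulr_suml.
  rewrite exchange_big /=; apply: eq_bigr => p _.
  under eq_bigr do rewrite mulr_sumr.
  rewrite exchange_big /=; apply: eq_bigr => q _.
  by rewrite mulr_sumr; apply: eq_bigr => al _ /=; ring.
have A_lim : A k @[k --> \oo] --> eval_comb s (kernel_comb K s).
  rewrite /eval_comb /kernel_comb; under eq_bigr do rewrite mulr_sumr.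
  rewrite (funext AE).
  apply: cvg_big => [|p _]; first exact: add_continuous.
  apply: cvg_big => [|q _]; first exact: add_continuous.
  rewrite mulrA; apply: cvgM; first exact: cvg_cst.
  exact: gauss_trunc_cvg.
rewrite -(cvg_lim _ A_lim)//; apply: nondecreasing_cvgn_le A_nd _ n.
exact: cvgP A_lim.
Qed.

End GaussianFeatures.

(** * Unisolvent nodes and the Vandermonde matrix *)

Section LowDegree.
Variable d : nat.

Definition low m : seq (multi_index d) := [seq al <- box d m | (mabs al <= m)%N].

Lemma mem_low m (al : multi_index d) : (al \in low m) = (mabs al <= m)%N.
Proof.
by rewrite mem_filter; case: (leqP (mabs al) m) => //= alm; rewrite mem_box_mabs.
Qed.

Lemma low_uniq m : uniq (low m).
Proof. by rewrite filter_uniq// box_uniq. Qed.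

(** Reading a multi-index as the tuple of its entries reduces the count to that of [d]-tuples of sum
    at most [m]. *)
Lemma size_low m : size (low m) = 'C(m + d, d).
Proof.
rewrite size_filter -sum1_count big_map big_enum_cond/=.
rewrite addnC -card_partial_ord_partitions -sum1dep_card.
pose f (g : {ffun 'I_d -> 'I_m.+1}) : d.-tuple 'I_m.+1 := [tuple g i | i < d].
rewrite [RHS](reindex f)/=; last first.
  apply: onW_bij; exists (fun t => [ffun i => tnth t i]) => [g|t].
    by apply/ffunP => i; rewrite ffunE tnth_mktuple.
  by apply: eq_from_tnth => i; rewrite tnth_mktuple ffunE.
apply: eq_bigl => g; rewrite big_map big_enum /mabs; congr (_ <= _)%N.
by apply: eq_bigr => i _; rewrite ffunE.
Qed.

Definition low_index m i : multi_index d := nth [ffun=> 0%N] (low m) i.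

Lemma big_low (R : nmodType) m N (F : multi_index d -> R) : N = 'C(m + d, d) ->
  \sum_(al <- low m) F al = \sum_(i < N) F (low_index m i).
Proof. by move=> ->; rewrite -size_low (big_nth [ffun=> 0%N]) big_mkord. Qed.

Lemma low_index_mabs m N (i : 'I_N) : N = 'C(m + d, d) ->
  (mabs (low_index m i) <= m)%N.
Proof.
by move=> NE; rewrite -mem_low mem_nth// size_low -NE ltn_ord.
Qed.

Lemma low_index_surj m N (al : multi_index d) : N = 'C(m + d, d) ->
  (mabs al <= m)%N -> exists i : 'I_N, al = low_index m i.
Proof.
move=> NE; rewrite -mem_low => alm; have := alm; rewrite -index_mem size_low -NE => iN.
by exists (Ordinal iN); rewrite /low_index nth_index.
Qed.

Lemma low_index_inj m N (i j : 'I_N) : N = 'C(m + d, d) ->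
  low_index m i = low_index m j -> i = j.
Proof.
move=> NE /eqP; rewrite nth_uniq ?size_low -?NE ?ltn_ord ?low_uniq//.
by move/eqP/val_inj.
Qed.

End LowDegree.

(** Uniqueness of expansions in base [B]: reduction modulo [B] isolates the lowest digit, and
    induction treats the quotients. *)
Lemma digits_inj B d (a b : 'I_d -> nat) :
  (forall i, (a i < B)%N) -> (forall i, (b i < B)%N) ->
  (\sum_i a i * B ^ i = \sum_i b i * B ^ i)%N -> a =1 b.
Proof.
elim: d a b => [|d IHd] a b aB bB; first by move=> _ [].
rewrite !big_ord_recl !expn0 !muln1.
have shift (c : 'I_d.+1 -> nat) : (\sum_(i < d) c (lift ord0 i) * B ^ lift ord0 i =
    (\sum_(i < d) c (lift ord0 i) * B ^ i) * B)%N.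
  by rewrite big_distrl; apply: eq_bigr => i _; rewrite /= expnSr mulnA.
rewrite !shift => ab; have ab0 : a ord0 = b ord0.
  by have := congr1 (modn^~ B) ab; rewrite /= ![(_ ord0 + _)%N]addnC !modnMDl !modn_small.
have B0 : (0 < B)%N by exact: leq_ltn_trans (aB ord0).
move: ab; rewrite ab0 => /addnI/eqP; rewrite eqn_pmul2r// => /eqP ab.
move=> i; case: (unliftP ord0 i) => [j|] ->//.
exact: (IHd (a \o lift ord0) (b \o lift ord0) (fun=> aB _) (fun=> bB _) ab).
Qed.

Lemma poly_horner0 (R : numFieldType) (p : {poly R}) : (forall t, p.[t] = 0) -> p = 0.
Proof.
move=> p0; apply/eqP/negPn/negP => p_neq0.
pose rs := [seq i%:R : R | i <- iota 0 (size p)].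
have : (size rs < size p)%N.
  apply: max_poly_roots => //; first by apply/allP => t _; apply/rootP.
  by rewrite map_inj_uniq ?iota_uniq// => i j /eqP; rewrite eqr_nat => /eqP.
by rewrite size_map size_iota ltnn.
Qed.

(* Kronecker substitution: at [x_i = t ^ ((n + 1) ^ i)] the monomials of the box
   become distinct powers of t. *)
Lemma monom_free (R : realType) d n (c : multi_index d -> R) :
  (forall x, \sum_(al <- box d n) c al * monom al x = 0) ->
  forall al, al \in box d n -> c al = 0.
Proof.
move=> c0; pose code (al : multi_index d) := (\sum_i al i * n.+1 ^ i)%N.
have code_inj : {in box d n &, injective code}.
  move=> al be; rewrite !mem_box => /forallP aln /forallP ben ab.
  by apply/ffunP; apply: digits_inj ab => i; rewrite ltnS.
pose p : {poly R} := \sum_(al <- box d n) c al *: 'X^(code al).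
have p0 : p = 0.
  apply: poly_horner0 => t; rewrite -(c0 (\row_i t ^+ (n.+1 ^ i))) horner_sum.
  apply: eq_bigr => al _; rewrite hornerZ hornerXn; congr (_ * _).
  rewrite /monom /code -prodrXr; apply: eq_bigr => i _.
  by rewrite mxE -exprM mulnC.
move=> al aln; have := congr1 (fun q : {poly R} => q`_(code al)) p0.
rewrite coef0 /p coef_sum (bigD1_seq al) ?box_uniq//= coefZ coefXn eqxx mulr1.
rewrite big_seq_cond big1 ?addr0// => be /andP[ben be_neq].
rewrite coefZ coefXn; case: eqP; rewrite ?mulr0// => /code_inj e.
by move: be_neq; rewrite e ?eqxx.
Qed.

Section Vandermonde.
Variables (R : realType) (d m N : nat) (Om : set 'rV[R]_d) (x : 'I_N -> Om).
Hypothesis Xuni : unisolvent m x.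

Definition vandermonde : 'M[R]_N :=
  \matrix_(i, j) monom (low_index d m i) (val (x j)).

(** A row in the left kernel is the coefficient vector of a polynomial of degree at most [m]
    vanishing at all nodes. Unisolvence makes this polynomial zero, and independence of the
    monomials makes the row zero. *)
Lemma vandermonde_unit : vandermonde \in unitmx.
Proof.
have [_ NE Xinj] := Xuni.
rewrite -row_free_unit -kermx_eq0; apply/eqP/row_matrixP => k; rewrite row0.
have : row k (kermx vandermonde) *m vandermonde = 0.
  by rewrite -row_mul mulmx_ker row0.
move: (row k _) => c cV.
(* The entries of [c] are transported from positions in [low] to multi-indices; by injectivity of
   [low_index] each sum has at most one term. *)
pose c' (al : multi_index d) := \sum_(i < N | low_index d m i == al) c ord0 i.
have c'E (i : 'I_N) : c' (low_index d m i) = c ord0 i.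
  by rewrite /c' (big_pred1 i)// => j; apply/eqP/eqP => [/low_index_inj->|->].
have p0 : (fun y => \sum_(al <- low d m) c' al * monom al y) = fun=> 0.
  apply: Xinj => [|n].
    by exists (low d m), c'; split=> // al; rewrite mem_low.
  rewrite /sigL /= (big_low _ NE).
  have := congr1 (fun A : 'rV_N => A ord0 n) cV.
  rewrite mxE [RHS]mxE => h; rewrite -[RHS]h.
  by apply: eq_bigr => i _; rewrite c'E [vandermonde _ _]mxE.
apply/rowP => i; rewrite mxE -c'E.
(* [monom_free] speaks of sums over a full box, so the coefficients are cut off above degree [m]. *)
pose c'' al := if (mabs al <= m)%N then c' al else 0.
have : c'' (low_index d m i) = 0.
  apply: (@monom_free _ _ m) => [y|].
    have := congr1 (fun f => f y) p0; rewrite /low big_filter big_mkcond /= => h.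
    rewrite -[RHS]h.
    by apply: eq_bigr => al _; rewrite /c''; case: ifP; rewrite ?mul0r.
  exact: mem_box_mabs (low_index_mabs i NE).
by rewrite /c'' (low_index_mabs i NE).
Qed.

Lemma unisolvent_weights_eq0 (c : 'rV[R]_N) :
  (forall al, (mabs al <= m)%N -> \sum_n c ord0 n * monom al (val (x n)) = 0) ->
  c = 0.
Proof.
have [_ NE _] := Xuni; move=> c0.
have : c *m vandermonde^T = 0.
  apply/rowP => i; rewrite !mxE -[RHS](c0 _ (low_index_mabs i NE)).
  by apply: eq_bigr => n _; rewrite !mxE.
by move/(congr1 (mulmx^~ (invmx vandermonde^T)));
  rewrite mulmxK ?unitmx_tr ?vandermonde_unit// mul0mx.
Qed.

End Vandermonde.

(** * Tails of the expansion *)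

Lemma esum_seq (R : realType) (I : choiceType) (D : set I) (r : seq I)
    (F : I -> \bar R) : uniq r -> (forall i, (0 <= F i)%E) ->
  (forall i, i \notin r -> F i = 0%E) ->
  (\esum_(i in D) F i = \sum_(i <- r | i \in D) F i)%E.
Proof.
move=> r_uniq F0 Fr; have G0 i : (0 <= if i \in D then F i else 0)%E by case: ifP.
rewrite esum_mkcond (esumID [set` r])//= [X in (_ + X)%E]esum1 ?adde0; last first.
  by move=> i [_ /negP ir]; case: ifP => // _; exact: Fr.
rewrite setTI esum_fset; [|exact: finite_seq|by move=> i _].
by rewrite -fsbig_seq// -big_mkcond.
Qed.

(** * Continuity of monomials, Gaussian factors and features *)

Section Continuity.
Variables (R : realType) (d : nat) (T : topologicalType) (v : T -> 'rV[R]_d).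
Hypothesis v_cont : continuous v.

Lemma coord_comp_continuous i : continuous (fun y => v y ord0 i).
Proof.
move=> y; apply: (@continuous_comp _ _ _ v (fun M : 'rV_d => M ord0 i)).
  exact: v_cont.
exact: coord_continuous.
Qed.

Lemma monom_continuous al : continuous (fun y => monom al (v y)).
Proof.
apply: continuous_big => [|i _ y]; first exact: mul_continuous.
apply: (@continuous_comp _ _ _ (fun y => v y ord0 i) (fun t : R => t ^+ al i)).
  exact: coord_comp_continuous.
exact: exprn_continuous.
Qed.

Lemma gauss_factor_continuous (k : R) z :
  continuous (fun y => expR (- sqnorm2 (v y - z) / k)).
Proof.
move=> y; apply: (@continuous_comp _ _ _ (fun y => - sqnorm2 (v y - z) / k) expR);
  last exact: continuous_expR.
apply: cvgM; last exact: cvg_cst.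
apply: cvgN; apply: (continuous_big (P := predT)) => [|i _ {}y].
  exact: add_continuous.
apply: (@continuous_comp _ _ _ (fun y => (v y - z) ord0 i) (fun t : R => t ^+ 2));
  last exact: exprn_continuous.
suff : continuous (fun y => (v y - z) ord0 i) by exact.
rewrite (_ : (fun y => _) = fun y => v y ord0 i - z ord0 i).
  by move=> {}y; apply: cvgB; [exact: coord_comp_continuous|exact: cvg_cst].
by apply/funext => w; rewrite !mxE.
Qed.

Lemma psi_continuous l al : continuous (fun y => psi l al (v y)).
Proof.
move=> y; apply: cvgM; last exact: cvg_cst.
apply: cvgM; last exact: monom_continuous.
suff : continuous (fun y => expR (- sqnorm2 (v y) / (2 * l ^+ 2))) by exact.
rewrite (_ : (fun y => _) = fun y => expR (- sqnorm2 (v y - 0) / (2 * l ^+ 2))).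
  exact: gauss_factor_continuous.
by apply/funext => w; rewrite subr0.
Qed.

End Continuity.

Section Tail.
Variables (R : realType) (d m : nat) (l0 : R).
Hypothesis l0_gt1 : 1 < l0.

Definition tail_term (al : multi_index d) (x : 'rV[R]_d) : R :=
  `|monom al x| / (l0 ^+ (mabs al - m.+1) * Num.sqrt (mfact al)%:R).

Let l0_gt0 : 0 < l0. Proof. exact: lt_trans l0_gt1. Qed.

Lemma tail_term_ge0 al x : 0 <= tail_term al x.
Proof. by rewrite divr_ge0 ?mulr_ge0 ?sqrtr_ge0 ?exprn_ge0// ltW. Qed.

(** For finitely supported coefficients the tail is a finite sum of monomials in absolute value, so
    that its continuity and dominatedness are immediate. *)
Lemma tail_series_box n a x : (forall al, al \notin box d n -> a al = 0) ->
  tail_series m l0 a x =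
  \sum_(al <- box d n | (m < mabs al)%N) `|a al| * tail_term al x.
Proof.
move=> a0; rewrite /tail_series (esum_seq _ (box_uniq d n)); last 2 first.
- move=> al; rewrite lee_fin mulr_ge0// divr_ge0// mulr_ge0 ?sqrtr_ge0// exprn_ge0//.
  exact: ltW.
- by move=> al /a0 ->; rewrite normr0 !mul0r.
rewrite sumEFin /=; apply: eq_big => [al|al _].
  by apply/idP/idP => [/set_mem|?]//; exact: mem_set.
by rewrite /tail_term mulrAC mulrA.
Qed.

(** Of the factor l^|al| in the denominator, l^(m+1) is kept as the rate and the remaining power is
    bounded below by that of [l0]; the Gaussian factor is at most 1. *)
Lemma psi_tail_le l al x : l0 <= l -> (m < mabs al)%N ->
  `|psi l al x| <= l ^- m.+1 * tail_term al x.
Proof.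
move=> l0l mal; have l_gt0 : 0 < l by exact: lt_le_trans l0l.
have f0 : 0 < Num.sqrt (mfact al)%:R :> R by rewrite sqrtr_gt0 mfact_gt0.
rewrite /psi /phi !normrM normfV normrM (ger0_norm (expR_ge0 _)).
rewrite (ger0_norm (sqrtr_ge0 _)) (ger0_norm (ltW (exprn_gt0 _ l_gt0))).
set k := (mabs al - m.+1)%N; set s := Num.sqrt _ in f0 *.
have pk0 : 0 < l ^+ k by rewrite exprn_gt0.
have pm0 : 0 < l ^+ m.+1 by rewrite exprn_gt0.
have qk0 : 0 < l0 ^+ k by rewrite exprn_gt0.
rewrite /tail_term -/k -/s -(subnKC mal) exprD -/k.
rewrite (_ : _ / _ = expR (- sqnorm2 x / (2 * l ^+ 2)) * (l ^+ k)^-1 *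
  (`|monom al x| / (l ^+ m.+1 * s))); last by field; rewrite !gt_eqF.
rewrite (_ : l ^- m.+1 * _ = (l0 ^+ k)^-1 * (`|monom al x| / (l ^+ m.+1 * s)));
  last by field; rewrite !gt_eqF.
apply: ler_wpM2r; first by rewrite divr_ge0// mulr_ge0// ltW.
rewrite -[leRHS]mul1r; apply: ler_pM; rewrite ?expR_ge0 ?invr_ge0 ?(ltW pk0)//.
- rewrite -expR0 ler_expR mulNr oppr_le0 divr_ge0//.
    by apply: sumr_ge0 => i _; exact: sqr_ge0.
  by rewrite mulr_ge0// sqr_ge0.
- by rewrite lef_pV2 ?posrE// lerXn2r// nnegrE ltW.
Qed.

(** By Cauchy-Schwarz it is enough that the squares of the tail terms sum to at most exp(|x|^2).
    After multiplication by exp(-|x|^2) they are dominated, as [l0] exceeds 1, by the diagonal of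
    the Gaussian expansion at length-scale 1. *)
Lemma tail_sum_le n a x : \sum_(al <- box d n) a al ^+ 2 <= 1 ->
  \sum_(al <- box d n | (m < mabs al)%N) `|a al| * tail_term al x <=
  expR (sqnorm2 x / 2).
Proof.
move=> a1; rewrite -ler_sqr ?nnegrE ?expR_ge0//; last first.
  by apply: sumr_ge0 => al _; rewrite mulr_ge0// tail_term_ge0.
apply: le_trans (sum_cauchy_schwarz _ _ _ _) _.
rewrite -[leRHS]mul1r; apply: ler_pM; try by apply: sumr_ge0 => al _; exact: sqr_ge0.
  apply: le_trans a1; rewrite [leLHS]big_mkcond; apply: ler_sum => al _.
  by case: ifP; rewrite ?sqr_ge0// real_normK ?num_real.
rewrite -[leRHS]mulr1 -(ler_pM2l (_ : 0 < expR (- sqnorm2 x / 2) ^+ 2)); last first.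
  by rewrite exprn_gt0// expR_gt0.
rewrite mulr1 -exprMn -expRD mulNr addNr expR0 expr1n.
apply: le_trans (gauss_trunc_diag_le1 ltr01 n x); rewrite mulr_sumr big_mkcond.
apply: ler_sum => al _; case: ifP => _; last by rewrite -expr2 sqr_ge0.
rewrite -expr2 -exprMn /psi /phi /tail_term !expr1n !mul1r.
rewrite -[leRHS]real_normK ?num_real// ler_sqr ?nnegrE//; last first.
  by rewrite mulr_ge0 ?expR_ge0// tail_term_ge0.
rewrite !normrM normfV (ger0_norm (expR_ge0 _)) (ger0_norm (sqrtr_ge0 _)).
rewrite mulr1 mulNr -mulrA; apply: ler_wpM2l; first exact: expR_ge0.
apply: ler_wpM2l => //; rewrite lef_pV2 ?posrE ?mulr_gt0 ?exprn_gt0// ?sqrtr_gt0 ?mfact_gt0//.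
by rewrite ler_peMl ?sqrtr_ge0// exprn_ege1// ltW.
Qed.

End Tail.

(** * The error of cubature rules exact on scaled monomials *)

Lemma poly_space_monom (R : realType) d m (al : multi_index d) :
  (mabs al <= m)%N -> poly_space m (@monom R d al).
Proof.
move=> alm; exists [:: al], (fun=> 1); split=> [be|]; first by rewrite inE => /eqP ->.
by apply/funext => y; rewrite big_seq1 mul1r.
Qed.

Section CubatureLinear.
Variables (R : realType) (T : Type) (N : nat) (x : 'I_N -> T) (w : 'rV[R]_N).

Lemma cubature_sum (I : Type) (r : seq I) (c : I -> R) (F : I -> T -> R) :
  cubature x w (fun y => \sum_(i <- r) c i * F i y) =
  \sum_(i <- r) c i * cubature x w (F i).
Proof.
rewrite /cubature; under eq_bigr do rewrite mulr_sumr.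
rewrite exchange_big /=; apply: eq_bigr => i _; rewrite mulr_sumr.
by apply: eq_bigr => n _; ring.
Qed.

Lemma cubature_le f g : (forall y, `|f y| <= g y) ->
  `|cubature x w f| <= \sum_n `|w ord0 n| * g (x n).
Proof.
move=> fg; apply: le_trans (ler_norm_sum _ _ _) (ler_sum _ _) => n _.
by rewrite normrM ler_wpM2l.
Qed.

End CubatureLinear.

Section Functional.
Variables (R : realType) (d : nat) (Om : set 'rV[R]_d) (L : (Om -> R) -> \bar R).
Hypothesis PL : positive_functional L.
Hypothesis L_poly : forall (k : nat) (p : 'rV[R]_d -> R), poly_space k p ->
  (L (sigL Om (fun y => `|p y|)%R) < +oo)%E.

Let Lam f := fine (L f).

Lemma set_val_continuous : continuous (set_val : Om -> 'rV[R]_d).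
Proof. exact: initial_continuous. Qed.

Lemma dominated_monom al : dominated L (sigL Om (monom al)).
Proof.
split; first exact: monom_continuous set_val_continuous _.
apply: (L_poly (k := mabs al) (p := monom al)).
exact: poly_space_monom.
Qed.

Lemma dominated1 : dominated L (fun=> 1).
Proof.
have := dominated_monom [ffun=> 0%N]; congr (dominated L _); apply/funext => y.
by rewrite /sigL /= /monom big1// => i _; rewrite ffunE expr0.
Qed.

Lemma dominated_cst (k : R) : dominated L (fun=> k).
Proof.
have c (k' : R) : continuous ((fun=> k') : Om -> R) by exact: cst_continuous.
have D0 : dominated L (fun=> 0).
  have h y : `|(fun=> 0 : R) y| <= (fun=> 1 : R) (y : Om) by rewrite normr0.
  exact: (dominated_le PL (c 0) dominated1 h).1.
have := dominated_lin PL k dominated1 D0.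
by congr (dominated L _); apply/funext => y; rewrite mulr1 addr0.
Qed.

Lemma fine_cst (k : R) : Lam (fun=> k) = k * Lam (fun=> 1).
Proof.
have := fine_posf_linear PL k dominated1 (dominated_cst 0).
rewrite (posf0 PL dominated1) => e; rewrite -[RHS]addr0 -[X in _ + X]/(fine 0%E) -e.
by congr (fine (L _)); apply/funext => y; rewrite mulr1 addr0.
Qed.

Lemma dominatedZ (k : R) f : dominated L f -> dominated L (fun y => k * f y).
Proof.
move=> Df; have := dominated_lin PL k Df (dominated_cst 0).
by congr (dominated L _); apply/funext => y; rewrite addr0.
Qed.

Lemma fineZ (k : R) f : dominated L f -> Lam (fun y => k * f y) = k * Lam f.
Proof.
move=> Df; have := fine_posf_linear PL k Df (dominated_cst 0).
rewrite (posf0 PL dominated1) => e; rewrite -[RHS]addr0 -[X in _ + X]/(fine 0%E) -e.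
by congr (fine (L _)); apply/funext => y; rewrite addr0.
Qed.

(** * The RKHS and its features at a fixed length-scale *)

Section FixedLength.
Variables (l : R) (H : inner_function_space R Om).
Hypotheses (l_gt0 : 0 < l) (HK : is_rkhs (@gauss_kernel R d Om l) H).

Let K1 y : @gauss_kernel R d Om l y y = 1.
Proof. exact: gauss1. Qed.

Lemma dominated_psi al : dominated L (sigL Om (psi l al)).
Proof.
pose k := (l ^+ mabs al * Num.sqrt (mfact al)%:R)^-1.
have cpsi := @psi_continuous _ _ _ _ set_val_continuous l al.
have h (y : Om) : `|psi l al (set_val y)| <= `|k * monom al (set_val y)|.
  have -> : psi l al (set_val y) =
      expR (- sqnorm2 (set_val y) / (2 * l ^+ 2)) * (k * monom al (set_val y)).
    by rewrite /psi /phi -/k -mulrA; congr (_ * _); exact: mulrC.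
  rewrite normrM ger0_norm ?expR_ge0// -[leRHS]mul1r; apply: ler_wpM2r => //.
  rewrite -expR0 ler_expR mulNr oppr_le0 divr_ge0//.
    by apply: sumr_ge0 => i _; exact: sqr_ge0.
  by rewrite mulr_ge0// sqr_ge0.
exact: (dominated_le PL cpsi (dominated_norm (dominatedZ k (dominated_monom al))) h).1.
Qed.

(** The Riesz theorem applies with bound 1: the square of [eval_comb] at one feature is a single
    term of the sum in [sum_sqr_eval_psi_le]. *)
Lemma psi_rkhs al :
  H (sigL Om (psi l al)) /\ fnorm H (sigL Om (psi l al)) <= 1.
Proof.
have h s : `|eval_comb s (sigL Om (psi l al))| <=
    1 * fnorm H (kernel_comb (@gauss_kernel R d Om l) s).
  rewrite mul1r -ler_sqr ?nnegrE ?fnorm_ge0// real_normK ?num_real//.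
  have Hs := kernel_comb_rkhs HK s.
  rewrite (sqr_fnorm HK)// (fdot_kernel_comb HK)//.
  apply: le_trans (sum_sqr_eval_psi_le l_gt0 set_val (mabs al) s).
  rewrite (bigD1_seq al) ?box_uniq ?mem_box_mabs//= lerDl.
  by apply: sumr_ge0 => be _; exact: sqr_ge0.
by have [? ? _] := rkhs_riesz HK ler01 K1 h.
Qed.

Lemma gauss_rkhs_continuous f : H f -> continuous f.
Proof.
apply: (@rkhs_continuous R Om (@gauss_kernel R d Om l) H HK K1) => y.
exact: (@gauss_factor_continuous _ _ _ _ set_val_continuous (2 * l ^+ 2) (set_val y)).
Qed.

(** As the kernel is 1 on the diagonal, [fnorm H f] bounds |f| uniformly, and constants are
    dominated. *)
Lemma rkhs_dominated f : H f ->
  dominated L f /\ `|Lam f| <= Lam (fun=> 1) * fnorm H f.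
Proof.
move=> Hf; rewrite mulrC -fine_cst.
apply: (dominated_le PL (gauss_rkhs_continuous Hf) (dominated_cst _)) => y.
by rewrite -[leRHS]mulr1 -sqrtr1 -(K1 y); exact: rkhs_point_le.
Qed.

(** Two approximations cost [e] each: [f] by a kernel combination in norm, hence of norm at most 1 +
    e, and that combination by finitely many features, uniformly. *)
Lemma rkhs_psi_approx f (e : R) : H f -> fnorm H f <= 1 -> 0 < e ->
  exists n (a : multi_index d -> R),
    \sum_(al <- box d n) a al ^+ 2 <= (1 + e) ^+ 2 /\
    forall y : Om, `|f y - \sum_(al <- box d n) a al * psi l al (\val y)| <= 2 * e.
Proof.
move=> Hf f1 e0.
have h s : `|eval_comb s f| <=
    fnorm H f * fnorm H (kernel_comb (@gauss_kernel R d Om l) s).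
  have Hs := kernel_comb_rkhs HK s.
  by rewrite -(fdot_kernel_comb HK)// [leRHS]mulrC; exact: fdot_le HK _ _ Hs Hf.
have [_ _ /(_ _ e0)[s hs]] := rkhs_riesz HK (fnorm_ge0 H f) K1 h.
have [n /(_ n (leqnn n)) hn] := kernel_comb_psi_approx l_gt0 set_val s e0.
have Hs := kernel_comb_rkhs HK s.
exists n, (fun al => eval_comb s (psi l al \o set_val)); split=> [|y].
  apply: le_trans (sum_sqr_eval_psi_le l_gt0 set_val n s) _.
  rewrite -(fdot_kernel_comb HK)// -(sqr_fnorm HK)//.
  rewrite ler_sqr ?nnegrE ?fnorm_ge0 ?addr_ge0 ?(ltW e0)//.
  by have := fnorm_le_add HK Hs Hf; lra.
have := rkhs_point_le HK y (rkhsB HK Hs Hf); rewrite K1 sqrtr1 mulr1 distrC => h1.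
have := ler_distD (kernel_comb (@gauss_kernel R d Om l) s y) (f y)
  (\sum_(al <- box d n) eval_comb s (psi l al \o set_val) * psi l al (\val y)).
have := hn y; lra.
Qed.

Section CubatureError.
Variables (m N : nat) (x : 'I_N -> Om) (w : 'rV[R]_N) (l0 CL : R).
Hypotheses (l0_gt1 : 1 < l0) (l0_le_l : l0 <= l).
Hypothesis L_tail : forall a : multi_index d -> R,
  (\esum_(al in [set: multi_index d]) (a al ^+ 2)%:E <= 1%:E)%E ->
  (L (sigL Om (tail_series m l0 a)) <= CL%:E)%E.
Hypothesis w_exact : forall al, (mabs al <= m)%N ->
  cubature x w (sigL Om (psi l al)) = Lam (sigL Om (psi l al)).

Let C := (CL + \sum_n `|w ord0 n| * expR (sqnorm2 (\val (x n)) / 2)) * l ^- m.+1.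

Let psi_sum n (a : multi_index d -> R) : Om -> R :=
  fun y => \sum_(al <- box d n) a al * sigL Om (psi l al) y.

Lemma cubature_psi_error_le n a : \sum_(al <- box d n) a al ^+ 2 <= 1 ->
  `|Lam (psi_sum n a) - cubature x w (psi_sum n a)| <= C.
Proof.
move=> a1; pose hi := [seq al <- box d n | (m < mabs al)%N].
pose G : Om -> R := fun y => \sum_(al <- hi) a al * sigL Om (psi l al) y.
have D0 := dominated_cst 0.
have [DG LamG] := dominated_sum PL hi a D0 dominated_psi.
(* Exactness cancels the features of degree at most [m]. *)
have -> : Lam (psi_sum n a) - cubature x w (psi_sum n a) = Lam G - cubature x w G.
  rewrite /Lam /psi_sum (dominated_sum PL _ a D0 dominated_psi).2 LamG !cubature_sum.
  rewrite -!sumrB /hi big_filter [RHS]big_mkcond; apply: eq_bigr => al _.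
  by case: ltnP => // /w_exact ->; rewrite subrr.
(* Only the coefficients in the box are controlled; extended by zero, they have total square sum at
   most 1, as [L_tail] requires. *)
pose b (al : multi_index d) := if al \in box d n then a al else 0.
have b0 (al : multi_index d) : al \notin box d n -> b al = 0 by rewrite /b => /negbTE ->.
pose tau : Om -> R := sigL Om (tail_series m l0 b).
have tauE : tau = fun y => \sum_(al <- hi) `|a al| * tail_term m l0 al (\val y).
  apply/funext => y; rewrite /tau /sigL /= (tail_series_box m l0_gt1 _ b0) /hi big_filter.
  by rewrite big_seq_cond [RHS]big_seq_cond; apply: eq_bigr => al /andP[h _]; rewrite /b h.
have Dtau : dominated L tau.
  rewrite tauE; refine (dominated_sum PL hi _ D0 _).1 => al.
  have := dominatedZ (l0 ^+ (mabs al - m.+1) * Num.sqrt (mfact al)%:R)^-1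
    (dominated_norm (dominated_monom al)).
  by congr (dominated L _); apply/funext => y; rewrite mulrC.
have Ltau : Lam tau <= CL.
  rewrite -lee_fin -(dominated_fin PL Dtau); apply: L_tail.
  rewrite (esum_seq _ (box_uniq d n)) => [|al|al /b0 ->].
  - rewrite sumEFin lee_fin; apply: le_trans a1.
    rewrite big_mkcond big_seq [leRHS]big_seq; apply: ler_sum => al aln.
    by case: ifP => _; rewrite ?sqr_ge0// /b aln.
  - by rewrite lee_fin sqr_ge0.
  - by rewrite expr0n.
have G_tau y : `|G y| <= l ^- m.+1 * tau y.
  rewrite tauE mulr_sumr; apply: le_trans (ler_norm_sum _ _ _) _.
  rewrite big_seq [leRHS]big_seq; apply: ler_sum => al.
  rewrite mem_filter => /andP[mal _]; rewrite normrM mulrCA ler_wpM2l//.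
  exact: psi_tail_le.
have lm0 : 0 <= l ^- m.+1 by rewrite invr_ge0 exprn_ge0// ltW.
have [_ LG] := dominated_le PL DG.1 (dominatedZ (l ^- m.+1) Dtau) G_tau.
rewrite -/(Lam _) -/(Lam _) fineZ// in LG.
apply: le_trans (ler_normB _ _) _; rewrite /C mulrDl; apply: lerD.
  by apply: le_trans LG _; rewrite mulrC ler_wpM2r.
(* At the nodes the tail is bounded by the exponential of [tail_sum_le], which does not depend on
   [l]. *)
apply: le_trans (cubature_le x w G_tau) _.
rewrite mulr_suml; apply: ler_sum => k _; rewrite -mulrA ler_wpM2l// mulrC ler_wpM2r//.
rewrite tauE /hi big_filter; exact: tail_sum_le.
Qed.

Lemma cubature_error_le f : H f -> fnorm H f <= 1 ->
  `|Lam f - cubature x w f| <= C.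
Proof.
(* [B] bounds the error of the rule on dominated functions of absolute value at most 1; it controls
   the approximation remainder [D]. *)
move=> Hf f1; pose B := Lam (fun=> 1) + \sum_n `|w ord0 n|.
have D0 := dominated_cst 0.
have err_le (e : R) : 0 < e -> `|Lam f - cubature x w f| <= C + e * (C + 2 * B).
  move=> e0; have e1 : 0 < 1 + e by rewrite addr_gt0.
  have [n [a [a_le f_le]]] := rkhs_psi_approx Hf f1 e0.
  (* Division by 1 + e brings the square sum of the coefficients down to at most 1. *)
  pose F := psi_sum n (fun al => a al / (1 + e)).
  pose D : Om -> R := fun y => f y - (1 + e) * F y.
  have [Df _] := rkhs_dominated Hf.
  have [DF _] := dominated_sum PL (box d n) (fun al => a al / (1 + e)) D0 dominated_psi.
  have FE y : (1 + e) * F y = \sum_(al <- box d n) a al * psi l al (\val y).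
    rewrite mulr_sumr; apply: eq_bigr => al _.
    by rewrite mulrA [(1 + e) * _]mulrC divfK ?gt_eqF.
  have D_le y : `|D y| <= 2 * e by rewrite /D FE.
  have DD : dominated L D.
    have := dominated_lin PL (- (1 + e)) DF Df.
    by congr (dominated L _); apply/funext => y; rewrite mulNr addrC.
  have [_ LD] := dominated_le PL DD.1 (dominated_cst (2 * e)) D_le.
  have fE : f = fun y => (1 + e) * F y + D y by apply/funext => y; rewrite /D addrC subrK.
  have F_le : `|Lam F - cubature x w F| <= C.
    apply: cubature_psi_error_le.
    under eq_bigr do rewrite expr_div_n; rewrite -mulr_suml ler_pdivrMr ?exprn_gt0//.
    by rewrite mul1r.
  have QD := cubature_le x w D_le.
  rewrite -mulr_suml in QD; rewrite -/(Lam _) -/(Lam _) fine_cst in LD.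
  rewrite fE {1}/Lam (fine_posf_linear PL _ DF DD) cubature_linear -!/(Lam _).
  rewrite (_ : _ - _ = (1 + e) * (Lam F - cubature x w F) + (Lam D - cubature x w D));
    last by ring.
  apply: le_trans (ler_normD _ _) _; rewrite normrM (gtr0_norm e1).
  have h1 := ler_wpM2l (ltW e1) F_le.
  have h2 := ler_normB (Lam D) (cubature x w D).
  by rewrite /B; lra.
apply/ler_addgt0Pr => e e0.
have k0 : 0 < `|C + 2 * B| + 1 by rewrite ltr_wpDl.
apply: le_trans (err_le _ (divr_gt0 e0 k0)) _; rewrite lerD2l.
rewrite mulrAC ler_pdivrMr// ler_wpM2l ?(ltW e0)//.
by apply: le_trans (ler_norm _) _; rewrite lerDl.
Qed.

End CubatureError.
End FixedLength.
End Functional.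

(** * The flat limit *)

Lemma rV_cvg (R : realType) (T : Type) (F : set_system T) N (f : T -> 'rV[R]_N)
    (a : 'rV[R]_N) : Filter F ->
  (forall i, f t ord0 i @[t --> F] --> a ord0 i) -> f t @[t --> F] --> a.
Proof.
move=> FF fa A [P Pa PA].
have : \forall t \near F, forall i, P ord0 i (f t ord0 i).
  by apply: filter_forall => i; exact: (fa i _ (Pa ord0 i)).
by apply: filterS => t Pt; apply: PA => i j; rewrite ord1.
Qed.

Lemma cvg_inv_pinfty (R : realType) : (l^-1 : R) @[l --> +oo] --> (0 : R).
Proof.
apply/gtr0_cvgV0; [exact: nbhs_pinfty_gt|exact: cvg_id].
Qed.

Lemma cvg_expR_inv_sqr (R : realType) (k : R) :
  expR (k / (2 * l ^+ 2)) @[l --> +oo] --> (1 : R).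
Proof.
suff : expR (k / (2 * l ^+ 2)) @[l --> +oo] --> expR (0 : R) by rewrite expR0.
apply: continuous_cvg; first exact: continuous_expR.
rewrite (_ : (fun l => _) = fun l => k / 2 * (l^-1 * l^-1)).
  have : k / 2 * (l^-1 * l^-1) @[l --> +oo] --> k / 2 * (0 * 0).
    by apply: cvgM; [exact: cvg_cst|apply: cvgM; exact: cvg_inv_pinfty].
  by rewrite !mulr0.
by apply/funext => l; rewrite expr2 !invfM !mulrA.
Qed.

Lemma phi_psi (R : realType) d (l : R) (al : multi_index d) : 0 < l ->
  phi l al = fun y => l ^+ mabs al * Num.sqrt (mfact al)%:R * psi l al y.
Proof.
move=> l0; apply/funext => y; rewrite /psi mulrC divfK// mulf_neq0//.
  by rewrite expf_neq0// gt_eqF.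
by rewrite gt_eqF// sqrtr_gt0 mfact_gt0.
Qed.

(** The quadratic form dominates the squares of the sums of [c] against the features, so these
    vanish up to degree [m]. Thus [c], multiplied by the Gaussian factors at the nodes, annihilates
    all monomials of degree at most [m], and unisolvence applies. *)
Lemma gauss_gram_inj (R : realType) (d m N : nat) (Om : set 'rV[R]_d)
    (x : 'I_N -> Om) (l : R) (c : 'rV[R]_N) : unisolvent m x -> 0 < l ->
  cubature x c (fun y => \sum_n c ord0 n * gauss_kernel l y (x n)) = 0 -> c = 0.
Proof.
move=> Xuni l0 c0; pose s := [seq (c ord0 n, x n) | n <- enum 'I_N].
have cE f : eval_comb s f = cubature x c f by rewrite /eval_comb big_map big_enum.
have sum0 : \sum_(al <- box d m) eval_comb s (psi l al \o \val) ^+ 2 = 0.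
  apply/eqP; rewrite eq_le; apply/andP; split; last first.
    by apply: sumr_ge0 => al _; exact: sqr_ge0.
  apply: le_trans (sum_sqr_eval_psi_le l0 \val m s) _; rewrite cE -[leRHS]c0.
  rewrite le_eqVlt; apply/orP; left; apply/eqP; congr cubature; apply/funext => y.
  by rewrite /kernel_comb big_map big_enum.
pose e n : R := expR (- sqnorm2 (\val (x n)) / (2 * l ^+ 2)).
have ce0 : (\row_n (c ord0 n * e n)) = 0.
  apply: (unisolvent_weights_eq0 Xuni) => al alm.
  have : eval_comb s (psi l al \o \val) == 0.
    rewrite -sqrf_eq0; move/eqP: sum0; rewrite psumr_eq0; last by move=> be _; exact: sqr_ge0.
    by move/allP/(_ al (mem_box_mabs alm)); rewrite implyTb.
  rewrite cE => /eqP h.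
  transitivity (l ^+ mabs al * Num.sqrt (mfact al)%:R * cubature x c (psi l al \o \val));
    last by rewrite h mulr0.
  rewrite /cubature mulr_sumr.
  apply: eq_bigr => n _; rewrite mxE /= mulrCA.
  by rewrite -[X in _ = _ * X](congr1 (fun f => f (\val (x n))) (phi_psi al l0)) /phi mulrA.
apply/rowP => n; have /rowP/(_ n) := ce0; rewrite !mxE => /eqP.
by rewrite mulf_eq0 (gt_eqF (expR_gt0 _)) orbF => /eqP.
Qed.

Theorem theorem2p4 (R : realType) (d m N : nat) (Om : set 'rV[R]_d)
    (L : (Om -> R) -> \bar R) (H : R -> inner_function_space R Om)
    (x : 'I_N -> Om) :
  Om° !=set0 ->
  positive_functional L ->
  (forall (k : nat) (p : 'rV[R]_d -> R), poly_space k p ->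
     (L (sigL Om (fun y => `|p y|)%R) < +oo)%E) ->
  (forall l : R, 0 < l -> is_rkhs (@gauss_kernel R d Om l) (H l)) ->
  unisolvent m x ->
  (forall al : multi_index d, (mabs al <= m)%N ->
     L (sigL Om (phi l al)) @[l --> +oo] --> L (sigL Om (monom al))) ->
  (exists l0 CL : R, 1 < l0 /\
     forall a : multi_index d -> R,
       (\esum_(al in [set: multi_index d]) (a al ^+ 2)%:E <= 1%:E)%E ->
       (L (sigL Om (tail_series m l0 a)) <= CL%:E)%E) ->
  exists (w_pol : 'rV[R]_N) (w_star : R -> 'rV[R]_N),
    [/\ unique (exact_on_poly_space m L x) w_pol,
        forall l : R, 0 < l ->
          unique (worst_case_optimal (H l) L x) (w_star l),
        w_star l @[l --> +oo] --> w_pol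
      & exists C : R, \forall l \near +oo,
          (worst_case_error (H l) L x (w_star l) <= (C * l ^- m.+1)%:E)%E].
Proof.
move=> _ PL L_poly HK Xuni L_phi [l0 [CL [l0_gt1 L_tail]]].
have [_ NE _] := Xuni; pose Lam f := fine (L f).
pose mi (i : 'I_N) := low_index d m i.
have mi_le i : (mabs (mi i) <= m)%N by exact: low_index_mabs.
pose V := vandermonde m x; pose U := invmx V^T.
have V_unit : V^T \in unitmx by rewrite unitmx_tr vandermonde_unit.
have VE w i : (w *m V^T) ord0 i = cubature x w (sigL Om (monom (mi i))).
  by rewrite mxE; apply: eq_bigr => n _; rewrite !mxE.
pose b := \row_i Lam (sigL Om (monom (mi i))).
pose bl l := \row_i Lam (sigL Om (phi l (mi i))).
have D0 : dominated L (fun=> 0) by exact: dominated_cst.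
have D_monom := dominated_monom L_poly.
have D_phi l al : 0 < l -> dominated L (sigL Om (phi l al)).
  move=> l_gt0; rewrite phi_psi//.
  exact: dominatedZ PL L_poly _ _ (dominated_psi PL L_poly l al).
have w_polP : unique (exact_on_poly_space m L x) (b *m U).
  split=> [p [s [c [s_le ->]]]|w w_exact].
    have [D E] := dominated_sum PL s c D0 D_monom.
    rewrite (dominated_fin PL D) E; congr _%:E.
    rewrite (cubature_sum x _ s c (fun al => sigL Om (monom al))).
    rewrite big_seq [RHS]big_seq; apply: eq_bigr => al /s_le alm.
    have [i ->] := low_index_surj NE alm.
    by rewrite -VE mulmxKV// mxE.
  suff -> : b = w *m V^T by rewrite mulmxK.
  apply/rowP => i; rewrite VE mxE /Lam.
  by rewrite -(w_exact (monom (mi i)))//; exact: poly_space_monom.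
(* For positive [l] the set is inhabited by [optimal_weights_unique]; the default 0 can only matter
   for other [l]. *)
pose w_star l := xget 0 [set w | unique (worst_case_optimal (H l) L x) w].
have LE l : 0 < l -> forall f, H l f -> L f = (Lam f)%:E.
  move=> lp f Hf; apply: (dominated_fin PL).
  exact: (rkhs_dominated PL L_poly (HK l lp) Hf).1.
have Lam_lin l : 0 < l -> forall (a : R) f g, H l f -> H l g ->
    Lam (fun y => a * f y + g y) = a * Lam f + Lam g.
  move=> lp a f g Hf Hg; apply: (fine_posf_linear PL).
    exact: (rkhs_dominated PL L_poly (HK l lp) Hf).1.
  exact: (rkhs_dominated PL L_poly (HK l lp) Hg).1.
have Lam_bd l : 0 < l -> forall f, H l f -> `|Lam f| <= Lam (fun=> 1) * fnorm (H l) f.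
  by move=> lp f Hf; exact: (rkhs_dominated PL L_poly (HK l lp) Hf).2.
have w_starP l : 0 < l -> unique (worst_case_optimal (H l) L x) (w_star l).
  move=> lp; apply: (@xgetPex _ 0 [set w | unique (worst_case_optimal (H l) L x) w]).
  apply: (optimal_weights_unique (HK l lp) (LE l lp) (Lam_lin l lp) (Lam_bd l lp)) => c.
  exact: (gauss_gram_inj Xuni lp).
have bl_cvg i : bl l ord0 i @[l --> +oo] --> b ord0 i.
  have h := L_phi (mi i) (mi_le i).
  rewrite (dominated_fin PL (D_monom (mi i))) in h.
  have {}h := fine_cvg h; rewrite mxE.
  suff -> : (fun l => bl l ord0 i) = fine \o (fun l => L (sigL Om (phi l (mi i)))).
    exact: h.
  by apply/funext => l; rewrite mxE.
(* On [phi l al] a rule acts as on x^al with its weights multiplied by the Gaussian factors at the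
   nodes. So the Vandermonde system is solved for the right-hand side [bl l], and the factors are
   divided out. *)
pose wphi l := \row_n ((bl l *m U) ord0 n * expR (sqnorm2 (\val (x n)) / (2 * l ^+ 2))).
(* A bound on the weights valid once 1 <= l and each entry of [bl l] is within 1 of its limit. *)
pose B n := (\sum_i (`|b ord0 i| + 1) * `|U i n|) * expR (sqnorm2 (\val (x n)) / 2).
have wphi_le : \forall l \near +oo, forall n, `|wphi l ord0 n| <= B n.
  have : \forall l \near +oo, forall i, `|b ord0 i - bl l ord0 i| < 1.
    apply: filter_forall => i; have /cvgrPdist_lt/(_ _ ltr01) := bl_cvg i.
    exact.
  move=> bl_near; near=> l => n.
  have l1 : 1 <= l by near: l; exact: nbhs_pinfty_ge.
  have bl1 : forall i, `|b ord0 i - bl l ord0 i| < 1 by near: l.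
  rewrite mxE normrM (ger0_norm (expR_ge0 _)); apply: ler_pM => //.
  - rewrite mxE; apply: le_trans (ler_norm_sum _ _ _) (ler_sum _ _) => i _.
    rewrite normrM ler_wpM2r//; have := bl1 i; rewrite distrC => h.
    by have := ler_normD (bl l ord0 i - b ord0 i) (b ord0 i); rewrite subrK; lra.
  - rewrite ler_expR; apply: ler_wpM2l; first by apply: sumr_ge0 => i _; exact: sqr_ge0.
    rewrite lef_pV2 ?posrE// ?mulr_gt0 ?exprn_gt0 ?(lt_le_trans ltr01 l1)//.
    by rewrite ler_peMr// exprn_ege1.
have wphi_exact l al : 0 < l -> (mabs al <= m)%N ->
    cubature x (wphi l) (sigL Om (psi l al)) = Lam (sigL Om (psi l al)).
  move=> lp /(low_index_surj NE)[i ->]; rewrite -/(mi i).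
  pose k := l ^+ mabs (mi i) * Num.sqrt (mfact (mi i))%:R : R.
  have k_neq0 : k != 0.
    by rewrite mulf_neq0 ?expf_neq0 ?(gt_eqF lp)// gt_eqF// sqrtr_gt0 mfact_gt0.
  apply: (mulfI k_neq0); rewrite -(fineZ PL L_poly k (dominated_psi PL L_poly l (mi i))).
  transitivity (bl l ord0 i); last by rewrite mxE phi_psi.
  rewrite -[bl l](mulmxKV V_unit) VE /cubature mulr_sumr.
  apply: eq_bigr => n _; rewrite mxE mulrCA.
  rewrite -[k * _](congr1 (fun f => f (\val (x n))) (phi_psi (mi i) lp)) /phi.
  by rewrite -mulrA [X in _ * X]mulrA -expRD mulNr addrN expR0 mul1r.
(* Replacing the weights of [wphi l] by their bounds frees the constant of [cubature_error_le] from
   [l]. *)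
pose C := CL + \sum_n B n * expR (sqnorm2 (\val (x n)) / 2).
have rate : \forall l \near +oo,
    (worst_case_error (H l) L x (w_star l) <= (C * l ^- m.+1)%:E)%E.
  near=> l; have lp : 0 < l by near: l; exact: nbhs_pinfty_gt.
  apply: (le_trans ((w_starP l lp).1 (wphi l))).
  apply: (worst_case_error_le (LE l lp)) => f Hf f1.
  apply: le_trans (cubature_error_le PL L_poly lp (HK l lp) l0_gt1 _ L_tail _ Hf f1) _.
  - by near: l; apply: nbhs_pinfty_ge; exact: num_real.
  - by move=> al; exact: wphi_exact.
  - rewrite ler_wpM2r ?invr_ge0 ?exprn_ge0 ?(ltW lp)// lerD2l.
    apply: ler_sum => n _; rewrite ler_wpM2r ?expR_ge0//.
    by move: n; near: l.
pose g l i := cubature x (w_star l) (sigL Om (phi l (mi i))).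
have g_cvg i : g l i @[l --> +oo] --> b ord0 i.
  suff h : (g l i - bl l ord0 i) @[l --> +oo] --> (0 : R).
    have := cvgD h (bl_cvg i); rewrite add0r => h2; 
    have e : (fun l => g l i) = (fun l => g l i - bl l ord0 i + bl l ord0 i).
      by apply/funext => l; rewrite subrK.
    by rewrite e; exact: h2.
  pose s : R := Num.sqrt (mfact (mi i))%:R.
  have s0 : 0 <= s by exact: sqrtr_ge0.
  have sC_cvg : s * C * l^-1 @[l --> +oo] --> (0 : R).
    rewrite -(mulr0 (s * C)); apply: cvgM; [exact: cvg_cst|exact: cvg_inv_pinfty].
  have sCN_cvg : - (s * C * l^-1) @[l --> +oo] --> (0 : R).
    by rewrite -oppr0; exact: cvgN.
  apply: squeeze_cvgr sCN_cvg sC_cvg; near=> l.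
  have l1 : 1 <= l by near: l; exact: nbhs_pinfty_ge.
  have lp : 0 < l := lt_le_trans ltr01 l1.
  have [r [r0 Er r_err]] := worst_case_error_fin (HK l lp) (LE l lp) (Lam_lin l lp)
    (Lam_bd l lp) x (w_star l).
  have r_le : r <= C * l ^- m.+1 by rewrite -lee_fin -Er; near: l.
  have [Hpsi psi1] := psi_rkhs lp (HK l lp) (mi i).
  have psi_err := le_trans (r_err _ Hpsi) (ler_piMr r0 psi1).
  (* [phi] is [k] times a feature of norm at most 1, so its error is at most k C / l^(m+1). As the
     degree is at most [m] and 1 <= l, this is at most s C / l. *)
  pose k := l ^+ mabs (mi i) * s.
  have k0 : 0 <= k by rewrite mulr_ge0// exprn_ge0// ltW.
  have -> : g l i - bl l ord0 i = - (k * (Lam (sigL Om (psi l (mi i))) -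
      cubature x (w_star l) (sigL Om (psi l (mi i))))).
    rewrite mulrBr opprB /g mxE phi_psi//; congr (_ - _).
      by rewrite /cubature mulr_sumr; apply: eq_bigr => n _; rewrite mulrCA.
    exact: (fineZ PL L_poly k (dominated_psi PL L_poly l (mi i))).
  rewrite -ler_norml normrN normrM (ger0_norm k0).
  apply: le_trans (ler_wpM2l k0 (le_trans psi_err r_le)) _.
  (* The sign of [C] is read off from 0 <= r <= C / l^(m+1). *)
  have C0 : 0 <= C.
    have := le_trans r0 r_le; rewrite pmulr_lge0// invr_gt0 exprn_gt0//.
  rewrite /k [_ * s]mulrC mulrACA.
  apply: ler_wpM2l; first exact: mulr_ge0.
  rewrite exprS invfM mulrCA ler_piMr ?invr_ge0 ?(ltW lp)//.
  by rewrite ler_pdivrMr ?exprn_gt0// mul1r ler_weXn2l.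
exists (b *m U), w_star; split=> //; last by exists C.
apply: rV_cvg => n.
(* Solving the Vandermonde system for the right-hand side [g l] and undoing the Gaussian factor
   recovers the optimal weight at node [n]; the factor tends to 1. *)
have : (\sum_i g l i * U i n) * expR (sqnorm2 (\val (x n)) / (2 * l ^+ 2))
    @[l --> +oo] --> (b *m U) ord0 n.
  rewrite mxE -[X in _ --> X]mulr1; apply: cvgM; last exact: cvg_expR_inv_sqr.
  apply: cvg_big => [|i _]; first exact: add_continuous.
  by apply: cvgM; [exact: g_cvg|exact: cvg_cst].
move=> h; suff e : \forall l \near +oo,
    (\sum_i g l i * U i n) * expR (sqnorm2 (\val (x n)) / (2 * l ^+ 2)) =
    w_star l ord0 n.
  exact: cvg_trans (near_eq_cvg e) h.
near=> l; have lp : 0 < l by near: l; exact: nbhs_pinfty_gt.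
pose u := \row_k (w_star l ord0 k * expR (- sqnorm2 (\val (x k)) / (2 * l ^+ 2))).
have uV : u *m V^T = \row_i g l i.
  apply/rowP => i; rewrite VE mxE /g /cubature; apply: eq_bigr => k _.
  by rewrite mxE -mulrA.
have : u = (\row_i g l i) *m U by rewrite -uV mulmxK.
move=> /rowP/(_ n); rewrite mxE [RHS]mxE => un.
rewrite (eq_bigr (fun i => (\row_i g l i) ord0 i * U i n)) -?un.
  by rewrite -mulrA -expRD mulNr addNr expR0 mulr1.
by move=> i _; rewrite mxE.
Unshelve. all: by end_near.
Qed.
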